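(* For every field $k$, there exist a finite-dimensional Morita context $k$-algebra $\Lambda=\begin{pmatrix}A&N\\ M&B\end{pmatrix}_{\phi,\psi}$ and support $\tau$-tilting corner modules $X$ (over $A$) and $Y$ (over $B$) for which the class $$\mathcal T_{X,Y}=\{W\in\operatorname{mod}\Lambda\mid We\in\operatorname{Fac}_AX,\ Wf\in\operatorname{Fac}_BY\}$$ is not functorially finite. Consequently, no condition-free finite bilateral construction can always produce a support $\tau$-tilting module $G$ satisfying $\operatorname{Fac}_\Lambda G=\mathcal T_{X,Y}$.
   Context: All algebras are finite-dimensional over the field $k$, and $\operatorname{mod}C$ is the category of finitely generated right $C$-modules. **Morita contexts.** $A,B$ are finite-dimensional algebras, ${}_AN_B$ and ${}_BM_A$ are finite-dimensional bimodules, and $\phi:N\otimes_BM\to A$, $\psi:M\otimes_AN\to B$ are bimodule maps with $\phi(n\otimes m)n'=n\psi(m\otimes n')$ and $m\phi(n\otimes m')=\psi(m\otimes n)m'$ for $n,n'\in N$, $m,m'\in M$. $\Lambda$ is the algebra of matrices $\begin{pmatrix}a&n\\ m&b\end{pmatrix}$ with matrix multiplication using $\phi,\psi$ for the products $N\times M\to A$ and $M\times N\to B$; $e,f$ are the diagonal idempotents corresponding to $A$ and $B$, so that for a right $\Lambda$-module $W$, $We$ is a right $A$-module and $Wf$ is a right $B$-module. **$\tau$-tilting theory.** For a finite-dimensional algebra $C$, $\tau_C$ is the Auslander–Reiten translation and $|T|$ is the number of isomorphism classes of indecomposable direct summands of $T$. A module $T$ is support $\tau$-tilting if $\operatorname{Hom}_C(T,\tau_CT)=0$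 and there is a projective $P$ with $\operatorname{Hom}_C(P,T)=0$ and $|T|+|P|=|C|$; such modules are represented by basic ones. $\operatorname{Fac}_CT$ is the class of factor modules of direct summands of finite direct sums of copies of $T$. A full subcategory $\mathcal C\subseteq\operatorname{mod}C$ is functorially finite if every module $L$ admits a left $\mathcal C$-approximation (a map $L\to C_L$ with $C_L\in\mathcal C$ through which every map from $L$ to an object of $\mathcal C$ factors) and, dually, a right $\mathcal C$-approximation. **Wording of the last sentence.** The phrase ''condition-free finite bilateral construction'' is used informally. It refers to a procedure gluing support $\tau$-tilting modules $X$ over $A$ and $Y$ over $B$ into a $\Lambda$-module by working with both corners (for example, starting from the induced modules $X\otimes_Ae\Lambda$ and $Y\otimes_Bf\Lambda$ and alternately correcting their two corner components by minimal left approximations into $\operatorname{Fac}_AX$ and $\operatorname{Fac}_BY$ together with pushouts), ending after finitely many steps, and applied to all $\Lambda,X,Y$ without further hypotheses. *)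

(* Defs.v *)
From HB Require Import structures.
From mathcomp Require Import all_boot all_order all_algebra all_field.

Set Implicit Arguments.
Unset Strict Implicit.
Unset Printing Implicit Defensive.

Import GRing.Theory.
Local Open Scope ring_scope.

(* A finite-dimensional k-algebra is a [falgType k]; it is associative, unital *)
(* and nonzero.  As such an algebra is finite-dimensional, a finitely          *)
(* generated module is the same thing as a finite-dimensional one, i.e. a      *)
(* [vectType k] with an action that is bilinear over k.                        *)

Record is_right_action (k : fieldType) (C : falgType k) (V : vectType k)
    (act : V -> C -> V) : Prop := IsRightAction {
  is_ract_linearl : forall c, linear (act^~ c);
  is_ract_linearr : forall v, linear (act v);
  is_ract1 : forall v, act v 1 = v;
  is_ractM : forall v c d, act v (c * d) = act (act v c) d }.

Record is_left_action (k : fieldType) (C : falgType k) (V : vectType k)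
    (act : C -> V -> V) : Prop := IsLeftAction {
  is_lact_linearl : forall v, linear (act^~ v);
  is_lact_linearr : forall c, linear (act c);
  is_lact1 : forall v, act 1 v = v;
  is_lactM : forall c d v, act (c * d) v = act c (act d v) }.

Record rmodule (k : fieldType) (C : falgType k) := RModule {
  rm_sort :> vectType k;
  ract : rm_sort -> C -> rm_sort;
  ractP : is_right_action ract }.

Record lmodule (k : fieldType) (C : falgType k) := LModule {
  lm_sort :> vectType k;
  lact : C -> lm_sort -> lm_sort;
  lactP : is_left_action lact }.

Record bimodule (k : fieldType) (A B : falgType k) := Bimodule {
  bm_sort :> vectType k;
  blact : A -> bm_sort -> bm_sort;
  bract : bm_sort -> B -> bm_sort;
  blactP : is_left_action blact;
  bractP : is_right_action bract;
  blractA : forall a v b, blact a (bract v b) = bract (blact a v) b }.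

Section Linear.
Variables (k : fieldType) (V W : vectType k) (f : V -> W).
Hypothesis f_lin : linear f.

Lemma lin0 : f 0 = 0.
Proof. by move: (f_lin (-1) 0 0); rewrite scaler0 addr0 scaleN1r addNr. Qed.

Lemma linD u v : f (u + v) = f u + f v.
Proof. by move: (f_lin 1 u v); rewrite !scale1r. Qed.

Lemma linZ a u : f (a *: u) = a *: f u.
Proof. by move: (f_lin a u 0); rewrite addr0 lin0 // addr0. Qed.

Lemma linfunE : linfun f =1 f.
Proof.
pose aux := GRing.isLinear.Build k V W _ f f_lin.
pose f' : {linear V -> W} := HB.pack f aux.
by move=> v; rewrite (lfunE f').
Qed.

End Linear.

Section Modules.
Variables (k : fieldType) (C : falgType k).
Implicit Types U V W T M P : rmodule C.

Definition is_hom U V (f : 'Hom(U, V)) : Prop :=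
  forall u c, f (ract u c) = ract (f u) c.

Definition surj (U V : vectType k) (f : 'Hom(U, V)) : Prop := limg f = fullv.

Definition iso_rmod U V : Prop :=
  exists f : 'Hom(U, V), is_hom f /\ bijective f.

Definition hom_zero U V : Prop :=
  forall f : 'Hom(U, V), is_hom f -> f = 0.

Fact regular_rmodP :
  is_right_action (fun v c : C => v * c).
Proof.
split=> [c a u v|v a c d|v|v c d]; last exact: mulrA; last exact: mulr1.
- by rewrite mulrDl scalerAl.
- by rewrite mulrDr scalerAr.
Qed.

Definition regular_rmod : rmodule C := RModule regular_rmodP.

Fact dsum_rmodP U V :
  is_right_action (fun (w : U * V) c => (ract w.1 c, ract w.2 c)).
Proof.
have [ul ur u1 uM] := ractP U; have [vl vr v1 vM] := ractP V.
split=> [c a [u v] [u' v']|[u v] a c d|[u v]|[u v] c d] /=.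
- by rewrite ul vl.
- by rewrite ur vr.
- by rewrite u1 v1.
- by rewrite uM vM.
Qed.

Definition dsum_rmod U V : rmodule C := RModule (dsum_rmodP U V).

Fact pow_rmodP T (n : nat) :
  is_right_action (fun (w : {ffun 'I_n -> T}) c => [ffun i => ract (w i) c]).
Proof.
have [ul ur u1 uM] := ractP T.
split=> [c a u v|u a c d|u|u c d]; apply/ffunP=> i; rewrite !ffunE //.
- exact: ul.
- exact: ur.
Qed.

Definition pow_rmod T (n : nat) : rmodule C := RModule (pow_rmodP T n).

Definition is_zero_mod V : Prop := forall v : V, v = 0.

Definition is_summand U T : Prop := exists V, iso_rmod (dsum_rmod U V) T.

Definition indecomposable U : Prop :=
  ~ is_zero_mod U /\
  forall V W, iso_rmod (dsum_rmod V W) U -> is_zero_mod V \/ is_zero_mod W.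

(* [num_indec T m] means |T| = m *)
Definition num_indec T (m : nat) : Prop :=
  exists S : 'I_m -> rmodule C,
    [/\ forall i, indecomposable (S i) /\ is_summand (S i) T,
        forall i j, iso_rmod (S i) (S j) -> i = j
      & forall U, indecomposable U -> is_summand U T ->
          exists i, iso_rmod U (S i)].

Definition basic T : Prop :=
  forall U, indecomposable U -> ~ is_summand (dsum_rmod U U) T.

Definition Fac T W : Prop :=
  exists (n : nat) (S : rmodule C) (f : 'Hom(S, W)),
    [/\ is_summand S (pow_rmod T n), is_hom f & surj f].

Definition projective P : Prop :=
  forall U V (g : 'Hom(U, V)) (f : 'Hom(P, V)),
    is_hom g -> surj g -> is_hom f ->
    exists h : 'Hom(P, U), is_hom h /\ (g \o h)%VF = f.

Definition is_submod V (U : {vspace V}) : Prop :=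
  forall u c, u \in U -> ract u c \in U.

Definition superfluous V (K : {vspace V}) : Prop :=
  forall U : {vspace V}, is_submod U -> (U + K = fullv)%VS -> U = fullv.

(* P1 --d--> P0 --p--> M --> 0 is exact, and both p : P0 -> M and the          *)
(* corestriction d : P1 -> Ker p are projective covers                         *)
Definition min_proj_presentation (P1 P0 M : rmodule C)
    (d : 'Hom(P1, P0)) (p : 'Hom(P0, M)) : Prop :=
  [/\ projective P1 /\ projective P0,
      is_hom d /\ is_hom p,
      surj p /\ limg d = lker p
    & superfluous (lker p) /\ superfluous (lker d)].

Definition left_approx (cC : rmodule C -> Prop) (L CL : rmodule C) (f : 'Hom(L, CL)) : Prop :=
  [/\ cC CL, is_hom f &
      forall (D : rmodule C) (g : 'Hom(L, D)), cC D -> is_hom g ->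
        exists h : 'Hom(CL, D), is_hom h /\ (h \o f)%VF = g].

Definition right_approx (cC : rmodule C -> Prop) (L CL : rmodule C) (f : 'Hom(CL, L)) : Prop :=
  [/\ cC CL, is_hom f &
      forall (D : rmodule C) (g : 'Hom(D, L)), cC D -> is_hom g ->
        exists h : 'Hom(D, CL), is_hom h /\ (f \o h)%VF = g].

(* A full subcategory of mod C is given by its class of objects. *)
Definition functorially_finite (cC : rmodule C -> Prop) : Prop :=
  forall L : rmodule C,
    (exists (CL : rmodule C) (f : 'Hom(L, CL)), left_approx cC f) /\
    (exists (CL : rmodule C) (f : 'Hom(CL, L)), right_approx cC f).

End Modules.

Section ARTranslation.
Variables (k : fieldType) (C : falgType k).

Definition is_lhom (U V : lmodule C) (f : 'Hom(U, V)) : Prop :=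
  forall c u, f (lact c u) = lact c (f u).

Section HomSpace.
Variables U V : rmodule C.

Definition hom_defect (c : C) (f : 'Hom(U, V)) : 'Hom(U, V) :=
  (f \o linfun (fun u : U => ract u c))%VF
  - (linfun (fun v : V => ract v c) \o f)%VF.

(* Hom_C(U, V), as a subspace of Hom_k(U, V); see [mem_hom_space] *)
Definition hom_space : {vspace 'Hom(U, V)} :=
  (\bigcap_(i < \dim {:C}) lker (linfun (hom_defect (vbasis {:C})`_i)))%VS.

Fact hom_defect_linear c : linear (hom_defect c).
Proof.
move=> a f g; apply/lfunP=> u; rewrite /hom_defect.
rewrite !(add_lfunE, opp_lfunE, scale_lfunE, comp_lfunE).
rewrite linearP scalerBr opprD !addrA; congr (_ + _).
by rewrite -!addrA; congr (_ + _); rewrite addrC.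
Qed.

Lemma hom_defectE c f u :
  hom_defect c f u = f (ract u c) - ract (f u) c.
Proof.
rewrite /hom_defect !(add_lfunE, opp_lfunE, comp_lfunE).
by rewrite !linfunE //; apply: is_ract_linearl (ractP _) c.
Qed.

Lemma mem_hom_space f : f \in hom_space <-> is_hom f.
Proof.
rewrite /hom_space; split=> [|fh]; last first.
  rewrite memvE; apply/subv_bigcapP=> i _; rewrite -memvE memv_ker.
  rewrite linfunE; last exact: hom_defect_linear.
  by apply/eqP/lfunP=> u; rewrite hom_defectE fh subrr zero_lfunE.
rewrite memvE => /subv_bigcapP fK u c.
have [_ ur _ _] := ractP U; have [_ vr _ _] := ractP V.
rewrite (coord_vbasis (memvf c)).
pose g c := f (ract u c); pose h c := ract (f u) c.
have gl : linear g by move=> a x y; rewrite /g ur linearP.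
have hl : linear h by move=> a x y; rewrite /h vr.
rewrite -/(g _) -/(h _) -(linfunE gl) -(linfunE hl) !linear_sum /=.
apply: eq_bigr=> i _; rewrite !linearZ /=; congr (_ *: _).
rewrite (linfunE gl) (linfunE hl) /g /h; apply/eqP.
rewrite -subr_eq0 -hom_defectE; move: (fK i isT); rewrite -memvE memv_ker.
by rewrite linfunE; [move/eqP->; rewrite zero_lfunE | exact: hom_defect_linear].
Qed.

End HomSpace.

Section Star.
Variable P : rmodule C.

(* P^* = Hom_C(P, C) with (c . g)(x) = c * g(x); see [star_actE] *)
Definition star_act (c : C) (g : subvs_of (hom_space P (regular_rmod C))) :
    subvs_of (hom_space P (regular_rmod C)) :=
  vsproj _ (linfun (fun x : C => c * x) \o vsval g)%VF.

Lemma amull_linear (c : C) : linear (fun x : C => c * x).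
Proof. by move=> a x y; rewrite mulrDr scalerAr. Qed.

Lemma star_actE c g x : vsval (star_act c g) x = c * vsval g x.
Proof.
rewrite /star_act vsprojK.
  by rewrite comp_lfunE linfunE //; exact: amull_linear.
have /mem_hom_space gh := subvsP g.
apply/mem_hom_space=> u d; rewrite !comp_lfunE !(linfunE (amull_linear c)) gh.
exact: mulrA.
Qed.

Fact star_actP : is_left_action star_act.
Proof.
split=> [g a c d|c a g h|g|c d g]; apply/val_inj/lfunP=> x /=;
  rewrite ?(add_lfunE, scale_lfunE, star_actE).
- by rewrite mulrDl scalerAl.
- by rewrite mulrDr scalerAr.
- by rewrite mul1r.
- by rewrite mulrA.
Qed.

Definition star : lmodule C := LModule star_actP.

End Star.

(* d^* : P0^* -> P1^*, g |-> g \o d; see [star_mapE] *)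
Definition star_map (P1 P0 : rmodule C) (d : 'Hom(P1, P0)) :
    'Hom(star P0, star P1) :=
  linfun (fun g : star P0 => vsproj _ (vsval g \o d)%VF : star P1).

Fact star_mapE (P1 P0 : rmodule C) (d : 'Hom(P1, P0)) (g : star P0) :
  is_hom d -> vsval (star_map d g) = (vsval g \o d)%VF.
Proof.
move=> dh; have gdh (f : star P0) :
    (vsval f \o d)%VF \in hom_space P1 (regular_rmod C).
  have /mem_hom_space fh := subvsP f.
  by apply/mem_hom_space=> u c; rewrite !comp_lfunE dh fh.
rewrite /star_map linfunE; first by rewrite vsprojK.
move=> a f h; apply/val_inj.
rewrite /= (vsprojK (gdh (a *: f + h))) (vsprojK (gdh f)) (vsprojK (gdh h)).
by apply/lfunP=> x; rewrite !(add_lfunE, scale_lfunE, comp_lfunE).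
Qed.

Fact dual_rmodP (V : lmodule C) :
  is_right_action
    (fun (xi : 'Hom(V, k^o)) c => (xi \o linfun (fun v : V => lact c v))%VF).
Proof.
have [ll lr l1 lM] := lactP V.
split=> [c a f g|f a c d|f|f c d]; apply/lfunP=> v;
  rewrite !(add_lfunE, scale_lfunE, comp_lfunE) ?linfunE ?l1 ?lM //.
by rewrite ll linearP.
Qed.

(* D V = Hom_k(V, k) with (xi . c)(v) = xi (c . v) *)
Definition dual_rmod (V : lmodule C) : rmodule C := RModule (dual_rmodP V).

(* Tr M is the cokernel of d^* for a minimal projective presentation d of M. *)
Definition is_transpose (M : rmodule C) (X : lmodule C) : Prop :=
  exists (P1 P0 : rmodule C) (d : 'Hom(P1, P0)) (p : 'Hom(P0, M)),
    min_proj_presentation d p /\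
    exists pi : 'Hom(star P1, X),
      [/\ is_lhom pi, surj pi & lker pi = limg (star_map d)].

(* N is a model of tau_C M = D Tr M, which is determined up to isomorphism. *)
Definition is_AR_translate (M N : rmodule C) : Prop :=
  exists X : lmodule C, is_transpose M X /\ iso_rmod N (dual_rmod X).

Definition tau_rigid (T : rmodule C) : Prop :=
  exists N, is_AR_translate T N /\ hom_zero T N.

Definition support_tau_tilting (T : rmodule C) : Prop :=
  tau_rigid T /\
  exists P : rmodule C,
    [/\ projective P, hom_zero P T &
        exists t p c : nat,
          [/\ num_indec T t, num_indec P p, num_indec (regular_rmod C) c
            & (t + p)%N = c]].

End ARTranslation.

(* A bimodule map N \otimes_B M -> A is given by the corresponding B-balanced  *)
(* map N x M -> A that is bilinear over k and A-linear on both sides, and       *)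
(* similarly for psi.                                                          *)
Record is_bimodule_pairing (k : fieldType) (A B : falgType k)
    (N : bimodule A B) (M : bimodule B A) (phi : N -> M -> A) : Prop := {
  pair_linearl : forall m, linear (phi^~ m);
  pair_linearr : forall n, linear (phi n);
  pair_balanced : forall n b m, phi (bract n b) m = phi n (blact b m);
  pair_lact : forall a n m, phi (blact a n) m = a * phi n m;
  pair_ract : forall n m a, phi n (bract m a) = phi n m * a }.

Record morita_context (k : fieldType) := MoritaContext {
  mcA : falgType k;
  mcB : falgType k;
  mcN : bimodule mcA mcB;
  mcM : bimodule mcB mcA;
  mc_phi : mcN -> mcM -> mcA;
  mc_psi : mcM -> mcN -> mcB;
  mc_phiP : is_bimodule_pairing mc_phi;
  mc_psiP : is_bimodule_pairing mc_psi;
  mc_assocN : forall n m n', blact (mc_phi n m) n' = bract n (mc_psi m n');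
  mc_assocM : forall m n m', bract m (mc_phi n m') = blact (mc_psi m n) m' }.

(* The matrix [a n; m b] is encoded as ((a, n), (m, b)). *)
Definition morita_alg (k : fieldType) (c : morita_context k) : Type :=
  ((mcA c * mcN c) * (mcM c * mcB c))%type.

Section MoritaAlgebra.
Variables (k : fieldType) (c : morita_context k).
Local Notation Lam := (morita_alg c).

HB.instance Definition _ := Vector.copy Lam ((mcA c * mcN c) * (mcM c * mcB c))%type.

Definition mat_mul (x y : Lam) : Lam :=
  let: ((a, n), (m, b)) := x in
  let: ((a', n'), (m', b')) := y in
  ((a * a' + mc_phi n m', blact a n' + bract n b'),
   (bract m a' + blact b m', mc_psi m n' + b * b')).

Definition mat_one : Lam := ((1, 0), (0, 1)).

Fact mat_mulA : associative mat_mul.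
Proof.
have [pl pr pb plc prc] := mc_phiP c; have [ql qr qb qlc qrc] := mc_psiP c.
have [nl1 nr1 _ nM1] := blactP (mcN c); have [nl2 nr2 _ nM2] := bractP (mcN c).
have [ml1 mr1 _ mM1] := blactP (mcM c); have [ml2 mr2 _ mM2] := bractP (mcM c).
move=> [[a n] [m b]] [[a' n'] [m' b']] [[a2 n2] [m2 b2]] /=.
congr ((_, _), (_, _)).
- rewrite (linD (pr _)) mulrDr mulrDl (linD (pl _)) mulrA plc prc pb !addrA.
  by congr (_ + _); rewrite -!addrA; congr (_ + _); rewrite addrC.
- rewrite (linD (nr1 _)) (linD (nr2 _)) (linD (nl1 _)) (linD (nl2 _)).
  rewrite nM1 nM2 blractA mc_assocN !addrA; congr (_ + _).
  by rewrite -!addrA; congr (_ + _); rewrite addrC.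
- rewrite (linD (mr1 _)) (linD (mr2 _)) (linD (ml1 _)) (linD (ml2 _)).
  rewrite mM1 mM2 blractA mc_assocM !addrA; congr (_ + _).
  by rewrite -!addrA; congr (_ + _); rewrite addrC.
- rewrite (linD (qr _)) mulrDr mulrDl (linD (ql _)) mulrA qlc qrc qb !addrA.
  by congr (_ + _); rewrite -!addrA; congr (_ + _); rewrite addrC.
Qed.

Fact mat_mul1x : left_id mat_one mat_mul.
Proof.
have [pl _ _ _ _] := mc_phiP c; have [ql _ _ _ _] := mc_psiP c.
have [_ _ n1 _] := blactP (mcN c); have [nl2 _ _ _] := bractP (mcN c).
have [_ _ m1 _] := blactP (mcM c); have [ml2 _ _ _] := bractP (mcM c).
move=> [[a n] [m b]] /=;
rewrite (lin0 (pl _)) (lin0 (ql _)) (lin0 (nl2 _)) (lin0 (ml2 _)).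
by rewrite n1 m1 !mul1r !addr0 !add0r.
Qed.

Fact mat_mulx1 : right_id mat_one mat_mul.
Proof.
have [_ pr _ _ _] := mc_phiP c; have [_ qr _ _ _] := mc_psiP c.
have [_ nr1 _ _] := blactP (mcN c); have [_ _ n1 _] := bractP (mcN c).
have [_ mr1 _ _] := blactP (mcM c); have [_ _ m1 _] := bractP (mcM c).
move=> [[a n] [m b]] /=.
rewrite (lin0 (pr _)) (lin0 (qr _)) (lin0 (nr1 _)) (lin0 (mr1 _)).
by rewrite n1 m1 !mulr1 !addr0 !add0r.
Qed.

Fact mat_mulDl : left_distributive mat_mul +%R.
Proof.
have [pl _ _ _ _] := mc_phiP c; have [ql _ _ _ _] := mc_psiP c.
have [nl1 _ _ _] := blactP (mcN c); have [nl2 _ _ _] := bractP (mcN c).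
have [ml1 _ _ _] := blactP (mcM c); have [ml2 _ _ _] := bractP (mcM c).
move=> [[a n] [m b]] [[a' n'] [m' b']] [[a2 n2] [m2 b2]] /=.
rewrite (linD (pl _)) (linD (ql _)) (linD (nl1 _)) (linD (nl2 _)).
rewrite (linD (ml1 _)) (linD (ml2 _)) !mulrDl.
by congr ((_, _), (_, _)); rewrite /= addrACA.
Qed.

Fact mat_mulDr : right_distributive mat_mul +%R.
Proof.
have [_ pr _ _ _] := mc_phiP c; have [_ qr _ _ _] := mc_psiP c.
have [_ nr1 _ _] := blactP (mcN c); have [_ nr2 _ _] := bractP (mcN c).
have [_ mr1 _ _] := blactP (mcM c); have [_ mr2 _ _] := bractP (mcM c).
move=> [[a n] [m b]] [[a' n'] [m' b']] [[a2 n2] [m2 b2]] /=.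
rewrite (linD (pr _)) (linD (qr _)) (linD (nr1 _)) (linD (nr2 _)).
rewrite (linD (mr1 _)) (linD (mr2 _)) !mulrDr.
by congr ((_, _), (_, _)); rewrite /= addrACA.
Qed.

Fact mat_one_neq0 : mat_one != 0.
Proof. by apply/eqP=> -[/eqP]; rewrite oner_eq0. Qed.

HB.instance Definition _ := GRing.Zmodule_isNzRing.Build Lam
  mat_mulA mat_mul1x mat_mulx1 mat_mulDl mat_mulDr mat_one_neq0.

Fact mat_scaleAl (a : k) (x y : Lam) : a *: (x * y) = (a *: x) * y.
Proof.
have [pl _ _ _ _] := mc_phiP c; have [ql _ _ _ _] := mc_psiP c.
have [nl1 _ _ _] := blactP (mcN c); have [nl2 _ _ _] := bractP (mcN c).
have [ml1 _ _ _] := blactP (mcM c); have [ml2 _ _ _] := bractP (mcM c).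
case: x y => [[x n] [m b]] [[x' n'] [m' b']].
congr ((_, _), (_, _)); rewrite /= scalerDr.
- by rewrite scalerAl (linZ (pl _)).
- by rewrite (linZ (nl1 _)) (linZ (nl2 _)).
- by rewrite (linZ (ml1 _)) (linZ (ml2 _)).
- by rewrite scalerAl (linZ (ql _)).
Qed.

HB.instance Definition _ := GRing.Lmodule_isLalgebra.Build k Lam mat_scaleAl.

Fact mat_scaleAr (a : k) (x y : Lam) : a *: (x * y) = x * (a *: y).
Proof.
have [_ pr _ _ _] := mc_phiP c; have [_ qr _ _ _] := mc_psiP c.
have [_ nr1 _ _] := blactP (mcN c); have [_ nr2 _ _] := bractP (mcN c).
have [_ mr1 _ _] := blactP (mcM c); have [_ mr2 _ _] := bractP (mcM c).
case: x y => [[x n] [m b]] [[x' n'] [m' b']].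
congr ((_, _), (_, _)); rewrite /= scalerDr.
- by rewrite scalerAr (linZ (pr _)).
- by rewrite (linZ (nr1 _)) (linZ (nr2 _)).
- by rewrite (linZ (mr1 _)) (linZ (mr2 _)).
- by rewrite scalerAr (linZ (qr _)).
Qed.

HB.instance Definition _ := GRing.Lalgebra_isAlgebra.Build k Lam mat_scaleAr.
HB.instance Definition _ := Algebra_isFalgebra.Build k Lam.

(* The (nonunital) inclusions of A = e Lam e and B = f Lam f into Lam. *)
Definition inA (a : mcA c) : Lam := ((a, 0), (0, 0)).
Definition inB (b : mcB c) : Lam := ((0, 0), (0, b)).

Fact inA_linear : linear inA.
Proof.
by move=> a x y; congr ((_, _), (_, _)); rewrite /= ?scaler0 ?addr0.
Qed.

Fact inB_linear : linear inB.
Proof.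
by move=> a x y; congr ((_, _), (_, _)); rewrite /= ?scaler0 ?addr0.
Qed.

Fact inAM a a' : inA (a * a') = inA a * inA a'.
Proof.
have [pl _ _ _ _] := mc_phiP c; have [ql _ _ _ _] := mc_psiP c.
have [_ nr1 _ _] := blactP (mcN c); have [nl2 _ _ _] := bractP (mcN c).
have [_ mr1 _ _] := blactP (mcM c); have [ml2 _ _ _] := bractP (mcM c).
congr ((_, _), (_, _)); rewrite /=.
- by rewrite (lin0 (pl _)) addr0.
- by rewrite (lin0 (nr1 _)) (lin0 (nl2 _)) addr0.
- by rewrite (lin0 (ml2 _)) (lin0 (mr1 _)) addr0.
- by rewrite (lin0 (ql _)) mul0r addr0.
Qed.

Fact inBM b b' : inB (b * b') = inB b * inB b'.
Proof.
have [pl _ _ _ _] := mc_phiP c; have [ql _ _ _ _] := mc_psiP c.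
have [_ nr1 _ _] := blactP (mcN c); have [nl2 _ _ _] := bractP (mcN c).
have [_ mr1 _ _] := blactP (mcM c); have [ml2 _ _ _] := bractP (mcM c).
congr ((_, _), (_, _)); rewrite /=.
- by rewrite (lin0 (pl _)) mul0r addr0.
- by rewrite (lin0 (nr1 _)) (lin0 (nl2 _)) addr0.
- by rewrite (lin0 (ml2 _)) (lin0 (mr1 _)) addr0.
- by rewrite (lin0 (ql _)) add0r.
Qed.

End MoritaAlgebra.

(* For a linear multiplicative, possibly nonunital, map i : A -> L and a right *)
(* L-module W, the subspace W (i 1) is a right A-module by w . a = w (i a).    *)
Section Corner.
Variables (k : fieldType) (A L : falgType k) (i : A -> L).
Hypotheses (i_lin : linear i) (iM : forall a b, i (a * b) = i a * i b).
Variable W : rmodule L.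

Definition corner_space : {vspace W} := limg (linfun (fun w : W => ract w (i 1))).

Definition corner_act (w : subvs_of corner_space) (a : A) :
    subvs_of corner_space :=
  vsproj _ (ract (vsval w) (i a)).

Fact corner_spaceP w : w \in corner_space <-> ract w (i 1) = w.
Proof.
have [l _ _ M] := ractP W.
split=> [/memv_imgP[u _ ->]|<-].
  by rewrite linfunE // -M -iM mulr1.
by rewrite -(linfunE (l _)) memv_img // memvf.
Qed.

Fact corner_actE w a : vsval (corner_act w a) = ract (vsval w) (i a).
Proof.
have [l _ _ M] := ractP W.
by rewrite /corner_act vsprojK //; apply/corner_spaceP; rewrite -M -iM mulr1.
Qed.

Fact corner_rmodP : is_right_action corner_act.
Proof.
have [l r _ M] := ractP W.
split=> [a x u v|u x a b|u|u a b]; apply/val_inj; rewrite /= ?corner_actE.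
- exact: l.
- by rewrite i_lin r.
- by apply/corner_spaceP; exact: subvsP.
- by rewrite iM M.
Qed.

Definition corner_rmod : rmodule A := RModule corner_rmodP.

End Corner.

Section GluedClass.
Variables (k : fieldType) (c : morita_context k).

(* the A-module W e and the B-module W f *)
Definition cornerA (W : rmodule (morita_alg c)) : rmodule (mcA c) :=
  corner_rmod (@inA_linear k c) (@inAM k c) W.
Definition cornerB (W : rmodule (morita_alg c)) : rmodule (mcB c) :=
  corner_rmod (@inB_linear k c) (@inBM k c) W.

(* the class T_{X,Y} *)
Definition glued_class (X : rmodule (mcA c)) (Y : rmodule (mcB c))
    (W : rmodule (morita_alg c)) : Prop :=
  Fac X (cornerA W) /\ Fac Y (cornerB W).

End GluedClass.

Definition basic_support_tau_tilting (k : fieldType) (C : falgType k)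
    (T : rmodule C) : Prop := support_tau_tilting T /\ basic T.

(* A procedure, in the widest sense, that assigns a Lam-module to every Morita *)
(* context over k and every pair of (basic) support tau-tilting modules over   *)
(* its two corners.                                                            *)
Definition gluing_procedure (k : fieldType) : Type :=
  forall (c : morita_context k) (X : rmodule (mcA c)) (Y : rmodule (mcB c)),
    basic_support_tau_tilting X -> basic_support_tau_tilting Y ->
    rmodule (morita_alg c).

(* Main.v *)
(* The algebra is the path algebra of the quiver 1 -> 2 <- 3 -> 4 <- 1 (type A~3), *)
(* with corners spanned by the arrows 1 -> 2 and 3 -> 4, i.e. two copies of the    *)
(* upper triangular 2x2 matrices [tri].  For X = Y = P1 + S1, T_{X,Y} consists of  *)
(* the representations in which the arrows 1 -> 2 and 3 -> 4 are onto.  On such a  *)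
(* G there is a linear map mu sending v in G_1 to some v' to which v is related    *)
(* by going once round the cycle.  Let R_n be k^n at each vertex, with  *)
(* identity maps except for a nilpotent Jordan block J on 3 -> 2.  If G generates  *)
(* R_n, there are a map h : G -> R_n and v in G_1 with h(v) a cyclic vector of J;  *)
(* as h(mu^i v) = J^i h(v), n <= dim G.  So no single module generates T_{X,Y},    *)
(* whereas a left approximation of the regular module, or a G with Fac G =         *)
(* T_{X,Y}, would do so.                                                           *)
Require Import Defs.
From HB Require Import structures.
From mathcomp Require Import all_boot all_order all_algebra all_field.

Set Implicit Arguments.
Unset Strict Implicit.
Unset Printing Implicit Defensive.

Import GRing.Theory.
Local Open Scope ring_scope.

(** If T_{X,Y} were functorially finite, a left approximation of the regular module would be a
    single member generating the whole class ([left_approx_regular_Fac]); a G with Fac G = T_{X,Y}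
    would be one as well. So it suffices that no fixed member generates all members.

    Over [tri], X = Y = [tilt] = P1 + S1 is support tau-tilting because tau of [tilt] is the simple
    module at vertex 2, which receives no nonzero map from a module generated at vertex 1; Fac
    [tilt] consists exactly of such modules ([Fac_tilt]). Hence T_{X,Y} only asks two opposite
    arrows of the four-cycle to be onto ([gluedP]). Inverting these arrows gives every member G a
    linear map [mu], and each hom from G to [band J] intertwines [mu] with J at vertex 1
    ([glued_monodromy]). For a Jordan block J of size dim G + 1, generation would make too many
    iterates of [mu] on one vector independent ([glued_not_finitely_generated]). *)

(* ((x, y), z) encodes the upper triangular matrix [x y; 0 z]. *)
Definition tri (k : fieldType) : Type := (k^o * k^o * k^o)%type.

(** * The algebra of upper triangular 2x2 matrices *)

Section TriangularAlgebra.
Variable k : fieldType.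
Local Notation tri := (tri k).

HB.instance Definition _ := Vector.copy tri (k^o * k^o * k^o)%type.

Lemma triP (x y : tri) :
  x.1.1 = y.1.1 -> x.1.2 = y.1.2 -> x.2 = y.2 -> x = y.
Proof. by case: x y => [[a b] c] [[a' b'] c'] /= -> -> ->. Qed.

Definition tri_mul (x y : tri) : tri :=
  (x.1.1 * y.1.1, x.1.1 * y.1.2 + x.1.2 * y.2, x.2 * y.2).
Definition tri_one : tri := (1, 0, 1).

Fact tri_mulA : associative tri_mul.
Proof.
move=> x y z; rewrite /tri_mul /=; congr (_, _, _); rewrite ?mulrA //.
by rewrite mulrDr mulrDl !mulrA addrA.
Qed.

Fact tri_mul1x : left_id tri_one tri_mul.
Proof. by move=> [[a b] c]; rewrite /tri_mul /= !mul1r mul0r addr0. Qed.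

Fact tri_mulx1 : right_id tri_one tri_mul.
Proof. by move=> [[a b] c]; rewrite /tri_mul /= !mulr1 mulr0 add0r. Qed.

Fact tri_mulDl : left_distributive tri_mul +%R.
Proof.
by move=> x y z; apply: triP; rewrite /= !mulrDl // addrACA //.
Qed.

Fact tri_mulDr : right_distributive tri_mul +%R.
Proof.
by move=> x y z; apply: triP; rewrite /= !mulrDr // addrACA //.
Qed.

Fact tri_one_neq0 : tri_one != 0.
Proof. by apply/eqP=> -[/eqP]; rewrite oner_eq0. Qed.

HB.instance Definition _ := GRing.Zmodule_isNzRing.Build tri
  tri_mulA tri_mul1x tri_mulx1 tri_mulDl tri_mulDr tri_one_neq0.

Fact tri_scaleAl (a : k) (x y : tri) : a *: (x * y) = (a *: x : tri) * y.
Proof.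
by apply: triP; rewrite /= ?scalerDr !scalerAl.
Qed.

HB.instance Definition _ := GRing.Lmodule_isLalgebra.Build k tri tri_scaleAl.

Fact tri_scaleAr (a : k) (x y : tri) : a *: (x * y) = x * (a *: y : tri).
Proof.
by apply: triP; rewrite /= ?scalerDr !scalerAr.
Qed.

HB.instance Definition _ := GRing.Lalgebra_isAlgebra.Build k tri tri_scaleAr.
HB.instance Definition _ := Algebra_isFalgebra.Build k tri.

Definition te1 : tri := (1, 0, 0).
Definition te2 : tri := (0, 0, 1).
Definition te12 : tri := (0, 1, 0).


Fact regularZ (a : k) (b : k^o) : a *: b = a * b. Proof. by []. Qed.

Definition tri_simp := (mulr0, mul0r, mulr1, mul1r, addr0, add0r).

Ltac tri_tac := by apply: triP; rewrite /= ?regularZ ?tri_simp.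

Fact te11 : te1 * te1 = te1. Proof. tri_tac. Qed.
Fact te1_12 : te1 * te12 = te12. Proof. tri_tac. Qed.
Fact tri_mul_te1 (a : tri) : a * te1 = a.1.1 *: te1. Proof. tri_tac. Qed.
Fact tri_mul_te12 (a : tri) : a * te12 = a.1.1 *: te12. Proof. tri_tac. Qed.
Fact tri_mul_te2 (a : tri) : a * te2 = a.1.2 *: te12 + a.2 *: te2.
Proof. tri_tac. Qed.
Fact te1_mul (a : tri) : te1 * a = a.1.1 *: te1 + a.1.2 *: te12.
Proof. tri_tac. Qed.
Fact te2_mul (a : tri) : te2 * a = a.2 *: te2. Proof. tri_tac. Qed.
Fact te_sum : te1 + te2 = 1. Proof. tri_tac. Qed.
End TriangularAlgebra.

(** * Homs, summands, Fac and projectives over an arbitrary algebra *)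

Lemma surjP (k : fieldType) (U V : vectType k) (f : 'Hom(U, V)) : surj f <-> forall v, exists u, f u = v.
Proof.
split=> [fs v|fs].
  have : v \in limg f by rewrite fs memvf.
  by case/memv_imgP=> u _ ->; exists u.
by apply/vspaceP=> v; rewrite memvf; have [u <-] := fs v; rewrite memv_img ?memvf.
Qed.

Section ModuleTheory.
Variables (k : fieldType) (C : falgType k).
Implicit Types (U V W T P Q : rmodule C) (c d : C).

Lemma ract1 U (u : U) : ract u 1 = u.
Proof. exact: is_ract1 (ractP U) u. Qed.

Lemma ractM U (u : U) c d : ract u (c * d) = ract (ract u c) d.
Proof. exact: is_ractM (ractP U) u c d. Qed.

Lemma ract_linearl U c : linear ((ract (r := U))^~ c).
Proof. exact: is_ract_linearl (ractP U) c. Qed.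

Lemma ract_linearr U (u : U) : linear (ract u).
Proof. exact: is_ract_linearr (ractP U) u. Qed.

Lemma ractDl U c (u v : U) : ract (u + v) c = ract u c + ract v c.
Proof. exact: linD (ract_linearl c) u v. Qed.

Lemma ractDr U (u : U) c d : ract u (c + d) = ract u c + ract u d.
Proof. exact: linD (ract_linearr u) c d. Qed.

Lemma ractZl U c a (u : U) : ract (a *: u) c = a *: ract u c.
Proof. exact: linZ (ract_linearl c) a u. Qed.

Lemma ractZr U (u : U) a c : ract u (a *: c) = a *: ract u c.
Proof. exact: linZ (ract_linearr u) a c. Qed.

Lemma ract0l U c : ract (0 : U) c = 0.
Proof. exact: lin0 (ract_linearl c). Qed.

Lemma ract0r U (u : U) : ract u 0 = 0.
Proof. exact: lin0 (ract_linearr u). Qed.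

Lemma is_hom_linfun U V (f : U -> V) :
  linear f -> (forall u c, f (ract u c) = ract (f u) c) -> is_hom (linfun f).
Proof. by move=> fl fh u c; rewrite !linfunE. Qed.

Lemma is_hom_id U : is_hom (\1%VF : 'Hom(U, U)).
Proof. by move=> u c; rewrite !id_lfunE. Qed.

Lemma is_hom_comp U V W (g : 'Hom(V, W)) (f : 'Hom(U, V)) :
  is_hom g -> is_hom f -> is_hom (g \o f)%VF.
Proof. by move=> gh fh u c; rewrite !comp_lfunE fh gh. Qed.

Lemma is_hom_scale U V a (f : 'Hom(U, V)) : is_hom f -> is_hom (a *: f).
Proof. by move=> fh u c; rewrite !scale_lfunE fh ractZl. Qed.

Lemma iso_rmodI U V (f : U -> V) :
  linear f -> (forall u c, f (ract u c) = ract (f u) c) -> bijective f ->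
  iso_rmod U V.
Proof.
move=> fl fh [g fK gK]; exists (linfun f); split; first exact: is_hom_linfun.
by exists g => x; rewrite linfunE.
Qed.

Lemma iso_rmodP U V :
  iso_rmod U V -> exists (f : 'Hom(U, V)) (g : 'Hom(V, U)),
    [/\ is_hom f, is_hom g, cancel f g & cancel g f].
Proof.
case=> f [fh [g fK gK]]; have gl : linear g := can2_linear fK gK.
exists f, (linfun g); split=> // [v c|u|v]; rewrite !linfunE //.
by rewrite -{1}(gK v) -fh fK.
Qed.

Lemma iso_rmod_refl U : iso_rmod U U.
Proof. by exists \1%VF; split; [exact: is_hom_id | exists id => x; rewrite id_lfunE]. Qed.

Lemma iso_rmod_sym U V : iso_rmod U V -> iso_rmod V U.
Proof.
by case/iso_rmodP=> f [g [_ gh fK gK]]; exists g; split=> //; exists f.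
Qed.

Fact dinl_linear U V : linear (fun u : U => (u, 0 : V)).
Proof. by move=> a u v; congr (_, _); rewrite /= scaler0 addr0. Qed.

Fact dinr_linear U V : linear (fun v : V => (0 : U, v)).
Proof. by move=> a u v; congr (_, _); rewrite /= scaler0 addr0. Qed.

Definition dinl U V : 'Hom(U, dsum_rmod U V) := linfun (fun u : U => (u, 0 : V)).
Definition dinr U V : 'Hom(V, dsum_rmod U V) := linfun (fun v : V => (0 : U, v)).
Definition dprl U V : 'Hom(dsum_rmod U V, U) := linfun (fun w : U * V => w.1).
Definition dprr U V : 'Hom(dsum_rmod U V, V) := linfun (fun w : U * V => w.2).

Lemma dinlE U V u : dinl U V u = (u, 0).
Proof. exact: linfunE (@dinl_linear U V) u. Qed.

Lemma dinrE U V v : dinr U V v = (0, v).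
Proof. exact: linfunE (@dinr_linear U V) v. Qed.

Lemma dprlE U V w : dprl U V w = w.1.
Proof. by rewrite /dprl linfunE. Qed.

Lemma dprrE U V w : dprr U V w = w.2.
Proof. by rewrite /dprr linfunE. Qed.

Lemma dinl_hom U V : is_hom (dinl U V).
Proof. by move=> u c; rewrite !dinlE /= ract0l. Qed.

Lemma dinr_hom U V : is_hom (dinr U V).
Proof. by move=> u c; rewrite !dinrE /= ract0l. Qed.

Lemma dprl_hom U V : is_hom (dprl U V).
Proof. by move=> u c; rewrite !dprlE. Qed.

Lemma dprr_hom U V : is_hom (dprr U V).
Proof. by move=> u c; rewrite !dprrE. Qed.

Lemma dsum_split U V (w : dsum_rmod U V) : w = dinl U V w.1 + dinr U V w.2.
Proof. by case: w => u v; rewrite dinlE dinrE; congr (_, _); rewrite /= ?addr0 ?add0r. Qed.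

Lemma iso_dsumC U V : iso_rmod (dsum_rmod U V) (dsum_rmod V U).
Proof.
apply: (@iso_rmodI (dsum_rmod U V) (dsum_rmod V U) (fun w => (w.2, w.1))) => //.
by exists (fun w => (w.2, w.1)) => -[].
Qed.

Lemma summand_retract U T :
  is_summand U T -> exists (i : 'Hom(U, T)) (r : 'Hom(T, U)),
    [/\ is_hom i, is_hom r & cancel i r].
Proof.
case=> V /iso_rmodP[f [g [fh gh fK _]]].
exists (f \o dinl U V)%VF, (dprl U V \o g)%VF; split.
- exact: is_hom_comp fh (@dinl_hom U V).
- exact: is_hom_comp (@dprl_hom U V) gh.
- by move=> u; rewrite !comp_lfunE fK dprlE dinlE.
Qed.

Lemma summand_dsuml U V T : is_summand (dsum_rmod U V) T -> is_summand U T.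
Proof.
case=> W [f [fh [g fK gK]]]; exists (dsum_rmod V W).
apply: (@iso_rmodI (dsum_rmod U (dsum_rmod V W)) T
          (fun w => f ((w.1, w.2.1), w.2.2))).
- by move=> a v w; rewrite -linearP.
- by move=> w c; rewrite -fh.
- exists (fun t => ((g t).1.1, ((g t).1.2, (g t).2))) => [[u [v w]]|t] /=.
    by rewrite fK.
  by rewrite -{4}(gK t); case: (g t) => -[].
Qed.

Lemma summand_iso_embedding U T Q :
  is_summand U T -> iso_rmod Q U ->
  exists j : 'Hom(Q, T), is_hom j /\ injective j.
Proof.
case/summand_retract=> i [r [ih _ iK]] /iso_rmodP[f [g [fh _ fK _]]].
exists (i \o f)%VF; split; first exact: is_hom_comp.
by move=> x y; rewrite !comp_lfunE => /(can_inj iK)/(can_inj fK).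
Qed.

Lemma num_indec2 T V1 V2 :
  indecomposable V1 -> indecomposable V2 -> is_summand V1 T -> is_summand V2 T ->
  ~ iso_rmod V1 V2 ->
  (forall U, indecomposable U -> is_summand U T -> iso_rmod U V1 \/ iso_rmod U V2) ->
  num_indec T 2.
Proof.
move=> V1i V2i V1T V2T V12 TV.
exists (fun i : 'I_2 => if i == ord0 then V1 else V2); split.
- by move=> i; case: ifP.
- move=> i j; case: (eqVneq i ord0) => [->|i0]; case: (eqVneq j ord0) => [->|j0] //.
    by move/iso_rmod_sym.
  by move=> _; apply/val_inj; case: i j i0 j0 => [[|[|?]] ?] [[|[|?]] ?].
- by move=> U Ui /(TV U Ui)[]; [exists ord0 | exists ord_max].
Qed.

Lemma num_indec_zero T : is_zero_mod T -> num_indec T 0.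
Proof.
move=> T0; exists (fun=> T).
split=> [[]//|[]//|U [U0 _] /summand_retract[i [r [_ _ iK]]]].
by case: U0 => u; rewrite -(iK u) (T0 (i u)) linear0.
Qed.

Section Submodule.
Variables (U : rmodule C) (K : {vspace U}) (KP : is_submod K).

Definition sub_act (w : subvs_of K) c : subvs_of K := vsproj K (ract (vsval w) c).

Lemma sub_actE w c : vsval (sub_act w c) = ract (vsval w) c.
Proof. by rewrite /sub_act vsprojK // KP // subvsP. Qed.

Fact sub_rmodP : is_right_action sub_act.
Proof.
split=> [c a u v|u a c d|u|u c d]; apply/val_inj; rewrite /= ?sub_actE.
- exact: ract_linearl.
- exact: ract_linearr.
- exact: ract1.
- exact: ractM.
Qed.

Definition sub_rmod : rmodule C := RModule sub_rmodP.
End Submodule.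

Lemma lker_submod U V (f : 'Hom(U, V)) : is_hom f -> is_submod (lker f).
Proof. by move=> fh u c; rewrite !memv_ker fh => /eqP->; rewrite ract0l. Qed.

(** The kernel of [r] complements the image of [s]; as [Q] is nonzero, indecomposability of [U]
    forces this kernel to vanish. *)
Lemma indecomposable_retract Q U (s : 'Hom(Q, U)) (r : 'Hom(U, Q)) :
  is_hom s -> is_hom r -> cancel s r -> ~ is_zero_mod Q -> indecomposable U ->
  iso_rmod U Q.
Proof.
move=> sh rh sK Q0 [_ Uind].
pose K := sub_rmod (lker_submod rh).
have kerP u : u - s (r u) \in lker r.
  by rewrite memv_ker linearB /= sK subrr.
have iso : iso_rmod (dsum_rmod Q K) U.
  apply: (@iso_rmodI (dsum_rmod Q K) U (fun w => s w.1 + vsval w.2)).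
  - by move=> a w w'; rewrite /= linearP /= scalerDr addrACA.
  - by move=> w c; rewrite /= sh ractDl (sub_actE (lker_submod rh)).
  - exists (fun u => (r u, vsproj (lker r) (u - s (r u)))) => [[q x]|u] /=.
      have rx : r (vsval x) = 0 by apply/eqP; rewrite -memv_ker subvsP.
      rewrite linearD /= sK rx addr0; congr (_, _).
      by apply/val_inj; rewrite /= addrC addKr vsprojK ?subvsP.
    by rewrite vsprojK // addrC subrK.
have [//|K0] := Uind _ _ iso.
exists r; split=> //; exists s => // u.
apply/eqP; rewrite -subr_eq0 -opprB oppr_eq0.
by rewrite -(vsprojK (kerP u)) (K0 (vsproj _ _)).
Qed.

(* [q] generates a simple submodule contained in every nonzero submodule. *)
Lemma indecomposable_socle Q (q : Q) :
  q != 0 -> (forall x : Q, x != 0 -> exists c, ract x c = q) -> indecomposable Q.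
Proof.
move=> q0 soc; split=> [Q0|V W [f [fh [g fK gK]]]]; first by rewrite (Q0 q) eqxx in q0.
have f0 : f 0 = 0 by rewrite linear0.
have nz x : x != 0 -> f x != 0 by apply: contra_neq => fx; apply: (can_inj fK); rewrite fx f0.
have [/eqP V0|/eqP V0] := boolP (fullv == 0%VS :> {vspace V}).
  by left=> v; apply/eqP; rewrite -memv0 -V0 memvf.
right=> w; apply/eqP/negPn/negP=> w0.
have v0 := memv_pick (fullv : {vspace V}).
have {}v0 : vpick (fullv : {vspace V}) != 0 by rewrite vpick0; apply/eqP.
move: (vpick _) v0 => v v0.
have [|c] := soc (f (v, 0)).
  by apply: nz; apply: contra_neq v0; case.
have [|d] := soc (f (0, w)).
  by apply: nz; apply: contra_neq w0; case.
(* [q] lies in the images of both summands, hence would be zero. *)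
rewrite -!fh => qd qc; have [/= vc _] := can_inj fK (etrans qd (esym qc)).
move: q0; rewrite -qc (_ : ract _ c = 0) ?f0 ?eqxx //.
by congr (_, _); rewrite /= -?vc ract0l.
Qed.

Lemma pow0_zero T : is_zero_mod (pow_rmod T 0).
Proof. by move=> v; apply/ffunP=> -[]. Qed.

Lemma summand_refl T : is_summand T T.
Proof.
exists (pow_rmod T 0); apply: (@iso_rmodI (dsum_rmod T (pow_rmod T 0)) T (fun w => w.1)) => //.
exists (fun t => (t, 0)) => // -[t v]; congr (_, _).
by rewrite (pow0_zero v).
Qed.

Definition pow_in T n (i : 'I_n) : 'Hom(T, pow_rmod T n) :=
  linfun (fun t : T => [ffun j => if j == i then t else 0] : {ffun 'I_n -> T}).

Lemma pow_inE T n (i : 'I_n) t :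
  pow_in T i t = [ffun j => if j == i then t else 0].
Proof.
rewrite /pow_in linfunE // => a u v; apply/ffunP=> j; rewrite !ffunE.
by case: ifP => _ //; rewrite scaler0 addr0.
Qed.

Lemma pow_in_hom T n (i : 'I_n) : is_hom (pow_in T i).
Proof.
move=> t c; rewrite !pow_inE; apply/ffunP=> j; rewrite !ffunE.
by case: ifP => _ //; rewrite ract0l.
Qed.

Lemma pow_split T n (w : pow_rmod T n) : w = \sum_(i < n) pow_in T i (w i).
Proof.
apply/ffunP=> j; rewrite sum_ffunE (bigD1 j) //= big1 => [|i ij].
  by rewrite pow_inE ffunE eqxx addr0.
by rewrite pow_inE ffunE eq_sym (negPf ij).
Qed.

Lemma Fac_gen T W n (h : 'I_n -> 'Hom(T, W)) :
  (forall i, is_hom (h i)) ->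
  (forall w, exists x : 'I_n -> T, \sum_(i < n) h i (x i) = w) -> Fac T W.
Proof.
move=> hh hs; pose f (w : pow_rmod T n) := \sum_(i < n) h i (w i).
have fl : linear f.
  move=> a u v; rewrite /f scaler_sumr -big_split /=; apply: eq_bigr=> i _.
  by rewrite !ffunE linearP.
exists n, (pow_rmod T n), (linfun f); split; first exact: summand_refl.
  apply: is_hom_linfun fl _ => u c; rewrite /f.
  rewrite (big_morph _ (ractDl c) (ract0l _ c)).
  by apply: eq_bigr=> i _; rewrite ffunE hh.
apply/surjP=> w; have [x <-] := hs w; exists [ffun i => x i].
by rewrite linfunE // /f; apply: eq_bigr=> i _; rewrite ffunE.
Qed.

Lemma Fac_refl T : Fac T T.
Proof.
apply: (@Fac_gen _ _ 1 (fun=> \1%VF)) => [_|w]; first exact: is_hom_id.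
by exists (fun=> w); rewrite big_ord1 id_lfunE.
Qed.

Lemma Fac_pow T W :
  Fac T W -> exists n (f : 'Hom(pow_rmod T n, W)), is_hom f /\ surj f.
Proof.
case=> n [S [f [/summand_retract[i [r [ih rh iK]]] fh /surjP fs]]].
exists n, (f \o r)%VF; split; first exact: is_hom_comp.
apply/surjP=> w; have [s <-] := fs w; exists (i s).
by rewrite comp_lfunE iK.
Qed.

(** The images of the homs from [T] span [W], so a functional vanishing on all of them would be
    zero. *)
Lemma Fac_functional T W (l : 'Hom(W, k^o)) w :
  Fac T W -> l w != 0 ->
  exists (h : 'Hom(T, W)) t, is_hom h /\ l (h t) != 0.
Proof.
case/Fac_pow=> n [f [fh /surjP fs]] lw0; have [x xw] := fs w.
have /existsP[i li] : [exists i, l (f (pow_in T i (x i))) != 0].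
  apply: contraNT lw0; rewrite negb_exists => /forallP l0.
  rewrite -xw (pow_split x) !linear_sum big1 // => i _.
  by apply/eqP; rewrite -[_ == _]negbK; exact: l0.
exists (f \o pow_in T i)%VF, (x i); rewrite comp_lfunE; split=> //.
exact: is_hom_comp fh (@pow_in_hom T n i).
Qed.

Lemma projective_dsum P Q :
  projective P -> projective Q -> projective (dsum_rmod P Q).
Proof.
move=> Pp Qp U V g f gh gs fh.
have [h1 [h1h h1E]] := Pp _ _ _ _ gh gs (is_hom_comp fh (@dinl_hom P Q)).
have [h2 [h2h h2E]] := Qp _ _ _ _ gh gs (is_hom_comp fh (@dinr_hom P Q)).
exists ((h1 \o dprl P Q) + (h2 \o dprr P Q))%VF; split=> [w c|].
  by rewrite !add_lfunE !comp_lfunE dprl_hom dprr_hom h1h h2h ractDl.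
apply/lfunP=> w; rewrite comp_lfunE add_lfunE linearD /= -!comp_lfunE !comp_lfunA.
rewrite h1E h2E !comp_lfunE -linearD /= dprlE dprrE; congr (f _).
by rewrite [RHS]dsum_split.
Qed.

(* Such a [P] is isomorphic to a right ideal [e C] with [e] idempotent, [q] *)
(* corresponding to [e] and [iota] to the inclusion.                        *)
Lemma projective_gen P (iota : P -> C) (q : P) :
  linear iota -> (forall p c, iota (ract p c) = iota p * c) ->
  (forall p, ract q (iota p) = p) -> projective P.
Proof.
move=> il ih qK U V g f gh gs fh; have [u gu] := (surjP g).1 gs (f q).
pose h p := ract u (iota p).
have hl : linear h by move=> a x y; rewrite /h il ract_linearr.
exists (linfun h); split.
  by apply: is_hom_linfun hl _ => p c; rewrite /h ih ractM.
by apply/lfunP=> p; rewrite comp_lfunE linfunE // /h gh gu -fh qK.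
Qed.

Lemma projective_zero P : is_zero_mod P -> projective P.
Proof.
move=> P0; apply: (@projective_gen _ (fun=> 0) 0) => [a x y|p c|p].
- by rewrite scaler0 addr0.
- by rewrite mul0r.
- by rewrite [RHS]P0 ract0r.
Qed.

(** Each basis vector of [W] is the value at 1 of a hom from the regular module; factoring these
    homs through [f] gives homs from [CL] sending [f 1] to the basis vectors. *)
Lemma left_approx_regular_Fac (cC : rmodule C -> Prop) (CL : rmodule C)
    (f : 'Hom(regular_rmod C, CL)) W :
  left_approx cC f -> cC W -> Fac CL W.
Proof.
case=> _ fh funiv WC; pose v i := (vbasis (fullv : {vspace W}))`_i.
pose g i : 'Hom(regular_rmod C, W) := linfun (ract (v i)).
have gE i c : g i c = ract (v i) c by rewrite /g linfunE //; exact: ract_linearr.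
have gh (i : 'I_(\dim (fullv : {vspace W}))) : is_hom (g i).
  by move=> c d; rewrite !gE /= ractM.
have [h hP] := fin_all_exists (fun i : 'I_(\dim (fullv : {vspace W})) => funiv W (g i) WC (gh i)).
apply: (@Fac_gen _ _ _ h) => [i|w]; first by case: (hP i).
exists (fun i => coord (vbasis fullv) i w *: f 1).
rewrite [RHS](coord_vbasis (memvf w)); apply: eq_bigr=> i _.
by rewrite linearZ /= -comp_lfunE (hP i).2 gE ract1.
Qed.

Lemma superfluous0 V (K : {vspace V}) : K = 0%VS -> superfluous K.
Proof. by move=> -> U _; rewrite addv0. Qed.

End ModuleTheory.

Lemma exists_functional (k : fieldType) (V : vectType k) (v : V) :
  v != 0 -> exists l : 'Hom(V, k^o), l v = 1.
Proof.
move=> v0; pose b := vbasis (fullv : {vspace V}).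
have /existsP[i ci] : [exists i, coord b i v != 0].
  apply: contraNT v0; rewrite negb_exists => /forallP c0.
  rewrite (coord_vbasis (memvf v)) big1 // => i _.
  by move: (c0 i); rewrite negbK => /eqP->; rewrite scale0r.
exists ((coord b i v)^-1 *: linfun (coord b i : V -> k^o)).
by rewrite scale_lfunE lfunE /= regularZ mulVf.
Qed.

(** * The three indecomposable modules over [tri] *)

Section TriangularModules.
Variable k : fieldType.
Local Notation tri := (tri k).
Local Notation e1 := (te1 k).
Local Notation e2 := (te2 k).
Local Notation e12 := (te12 k).
Implicit Types U V W : rmodule tri.

Fact P1_rmodP : is_right_action (fun (v : k^o * k^o) (a : tri) =>
  (v.1 * a.1.1, v.1 * a.1.2 + v.2 * a.2) : k^o * k^o).
Proof.
split=> [c a u v|u a c d|[x y]|u c d].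
- by congr (_, _); rewrite /= ?scalerDr !mulrDl !scalerAl // addrACA.
- by congr (_, _); rewrite /= ?scalerDr !mulrDr !scalerAr // addrACA.
- by congr (_, _); rewrite /= ?tri_simp.
- by congr (_, _); rewrite /= ?mulrDr ?mulrDl !mulrA // addrA.
Qed.

Fact S1_rmodP : is_right_action (fun (v : k^o) (a : tri) => v * a.1.1).
Proof.
split=> [c a u v|u a c d|x|u c d] /=.
- by rewrite mulrDl scalerAl.
- by rewrite mulrDr scalerAr.
- by rewrite mulr1.
- by rewrite mulrA.
Qed.

Fact S2_rmodP : is_right_action (fun (v : k^o) (a : tri) => v * a.2).
Proof.
split=> [c a u v|u a c d|x|u c d] /=.
- by rewrite mulrDl scalerAl.
- by rewrite mulrDr scalerAr.
- by rewrite mulr1.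
- by rewrite mulrA.
Qed.

Definition P1 : rmodule tri := RModule P1_rmodP.
Definition S1 : rmodule tri := RModule S1_rmodP.
Definition S2 : rmodule tri := RModule S2_rmodP.

Lemma ract_e1_e12 U (u : U) : ract (ract u e1) e12 = ract u e12.
Proof. by rewrite -ractM te1_12. Qed.

Lemma ract_split U (u : U) : u = ract u e1 + ract u e2.
Proof. by rewrite -ractDr te_sum ract1. Qed.

Lemma S1_indecomposable : indecomposable S1.
Proof.
apply: (@indecomposable_socle _ _ S1 1) => [|x x0]; first exact: oner_neq0.
by exists (x^-1 *: 1); rewrite ractZr ract1 regularZ mulVf.
Qed.

Lemma S2_indecomposable : indecomposable S2.
Proof.
apply: (@indecomposable_socle _ _ S2 1) => [|x x0]; first exact: oner_neq0.
by exists (x^-1 *: 1); rewrite ractZr ract1 regularZ mulVf.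
Qed.

Lemma P1_indecomposable : indecomposable P1.
Proof.
apply: (@indecomposable_socle _ _ P1 (0, 1)) => [|[x y] xy0].
  by apply/eqP => -[/eqP]; rewrite oner_eq0.
have [x0|x0] := eqVneq x 0.
  have y0 : y != 0 by apply: contra_neq xy0 => ->; rewrite x0.
  by exists (y^-1 *: e2); rewrite ractZr; congr (_, _);
    rewrite /= !regularZ !tri_simp ?mulVf.
by exists (x^-1 *: e12); rewrite ractZr; congr (_, _);
    rewrite /= !regularZ !tri_simp ?mulVf.
Qed.

(** [P1] and [S2] are the right ideals [e1 tri] and [e2 tri]. *)
Definition iotaP1 (v : P1) : tri := (v.1, v.2, 0).
Definition iotaS2 (v : S2) : tri := (0, 0, v).

Fact iotaP1_linear : linear iotaP1.
Proof. by move=> a v w; apply: triP; rewrite //= scaler0 addr0. Qed.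

Fact iotaS2_linear : linear iotaS2.
Proof. by move=> a v w; apply: triP; rewrite //= scaler0 addr0. Qed.

Fact iotaP1_ract v a : iotaP1 (ract v a) = iotaP1 v * a.
Proof. by apply: triP; rewrite //= mul0r. Qed.

Fact iotaS2_ract v a : iotaS2 (ract v a) = iotaS2 v * a.
Proof. by apply: triP; rewrite //= ?tri_simp. Qed.

Fact P1_gen v : ract ((1, 0) : P1) (iotaP1 v) = v.
Proof. by case: v => x y; congr (_, _); rewrite /= ?tri_simp. Qed.

Fact S2_gen v : ract (1 : S2) (iotaS2 v) = v.
Proof. exact: mul1r. Qed.

Lemma P1_projective : projective P1.
Proof. exact: projective_gen iotaP1_linear iotaP1_ract P1_gen. Qed.

Lemma S2_projective : projective S2.
Proof. exact: projective_gen iotaS2_linear iotaS2_ract S2_gen. Qed.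

(** This realises Hom(e1 tri, U) = U e1; only [u e1] matters. *)
Definition P1_hom U (u : U) : 'Hom(P1, U) := linfun (fun v : P1 => ract u (iotaP1 v)).

Lemma P1_homE U (u : U) v : P1_hom u v = ract u (iotaP1 v).
Proof. by rewrite /P1_hom linfunE // => a x y; rewrite iotaP1_linear ract_linearr. Qed.

Lemma P1_homP U (u : U) : is_hom (P1_hom u).
Proof. by move=> v c; rewrite !P1_homE iotaP1_ract ractM. Qed.

Lemma P1_e12 (v : P1) : ract v e12 = (0, v.1) :> P1.
Proof. by congr (_, _); rewrite /= ?tri_simp. Qed.

Lemma S1_e12 (v : S1) : ract v e12 = 0.
Proof. exact: mulr0. Qed.

Lemma S2_e12 (v : S2) : ract v e12 = 0.
Proof. exact: mulr0. Qed.

Lemma not_iso_P1 V : (forall v : V, ract v e12 = 0) -> ~ iso_rmod P1 V.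
Proof.
move=> V0 /iso_rmodP[f [g [fh gh fK gK]]].
have : ract ((1, 0) : P1) e12 = 0 by apply: (can_inj fK); rewrite fh V0 linear0.
by rewrite P1_e12 => -[/eqP]; rewrite oner_eq0.
Qed.

(* A nonzero [u e12] spans a copy of the injective module P1; if [U e12 = 0],    *)
(* then [U] is semisimple.                                                       *)
Lemma tri_indecomposable U : indecomposable U ->
  [\/ iso_rmod U P1, iso_rmod U S1 | iso_rmod U S2].
Proof.
move=> Uind; have [U0 _] := Uind.
(* Linear maps between finite-dimensional spaces have decidable equality, so no classical axiom is
   called upon. *)
have ract_dec (a : tri) : (exists u : U, ract u a != 0) \/ (forall u : U, ract u a = 0).
  have [/eqP a0|a0] := boolP (linfun (fun u : U => ract u a) == 0).
    right=> u; have := congr1 (fun f : 'Hom(U, U) => f u) a0.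
    by rewrite linfunE ?zero_lfunE //; exact: ract_linearl.
  left; have [/eqP/vspaceP f0|] := boolP (limg (linfun (fun u : U => ract u a)) == 0%VS).
    case/negP: a0; apply/eqP/lfunP=> u; rewrite zero_lfunE.
    by apply/eqP; rewrite -memv0 -f0 memv_img ?memvf.
  move=> /negPf f0; have := memv_pick (limg (linfun (fun u : U => ract u a))).
  case/memv_imgP=> u _ uE; exists u.
  rewrite -(linfunE (@ract_linearl _ _ _ a)) -uE vpick0 f0 //.
have [[u ue12]|e12_0] := ract_dec e12.
  have [l lu] := exists_functional ue12; apply: Or31.
  (* As [P1] is the dual of the left module [tri e2], a functional on [U e2] amounts to a map from
     [U] to [P1]; the normalisation [l (u e12) = 1] makes it a retraction of [P1_hom u]. *)
  pose r (v : U) : P1 := (l (ract v e12), l (ract v e2)).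
  have rl : linear r.
    by move=> a v w; congr (_, _); rewrite ract_linearl linearP.
  apply: (@indecomposable_retract _ _ P1 U (P1_hom u) (linfun r)) => //.
  - exact: P1_homP.
  - apply: is_hom_linfun => // v a; rewrite /r -!ractM tri_mul_te12 tri_mul_te2.
    rewrite !(ractDr, ractZr) linearD !linearZ /=.
    by congr (_, _); rewrite /= !regularZ; rewrite ?(mulrC a.1.1) ?(mulrC a.1.2) ?(mulrC a.2).
  - move=> v; rewrite linfunE // P1_homE /r -!ractM tri_mul_te12 tri_mul_te2.
    by rewrite scale0r addr0 !ractZr !linearZ /= lu; case: v => x y; congr (_, _); exact: mulr1.
  - by case: P1_indecomposable.
(* From here on [e12] acts as zero, so a nonzero [u e1] spans a copy of [S1], split off by a
   functional. *)
have [[u ue1]|e1_0] := ract_dec e1.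
  have [l lu] := exists_functional ue1; apply: Or32.
  pose s (v : S1) : U := (v : k) *: ract u e1.
  pose r (v : U) : S1 := l (ract v e1).
  have sl : linear s.
    by move=> a v w; rewrite /s scalerDl scalerA.
  have rl : linear r.
    by move=> a v w; rewrite /r ract_linearl linearP.
  apply: (@indecomposable_retract _ _ S1 U (linfun s) (linfun r)) => //.
  - apply: is_hom_linfun => // v a; rewrite /s ractZl -ractM te1_mul.
    by rewrite ractDr !ractZr e12_0 scaler0 addr0 scalerA.
  - apply: is_hom_linfun => // v a; rewrite /r -!ractM tri_mul_te1.
    by rewrite ractZr linearZ /= regularZ mulrC.
  - move=> v; rewrite !linfunE // /r /s ractZl linearZ /= -ractM te11 lu.
    exact: mulr1.
  - by case: S1_indecomposable.
have e2E (u : U) : ract u e2 = u by rewrite {2}[u]ract_split e1_0 add0r.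
have [[u]|u0] := ract_dec e2; last by case: U0 => u; rewrite -[u]e2E.
rewrite e2E => u0.
have [l lu] := exists_functional u0; apply: Or33.
pose s (v : S2) : U := (v : k) *: u.
have sl : linear s by move=> a v w; rewrite /s scalerDl scalerA.
have actE (v : U) a : ract v a = a.2 *: v.
  by rewrite -{1}[v]e2E -ractM te2_mul ractZr e2E.
apply: (@indecomposable_retract _ _ S2 U (linfun s) l) => //.
- by apply: is_hom_linfun => // v a; rewrite /s actE scalerA mulrC.
- by move=> v a; rewrite actE linearZ /= regularZ mulrC.
- by move=> v; rewrite linfunE // linearZ /= lu; exact: mulr1.
- by case: S2_indecomposable.
Qed.

End TriangularModules.

(** * P1 + S1 is a basic support tau-tilting module *)

Section SupportTauTilting.
Variable k : fieldType.
Local Notation tri := (tri k).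
Local Notation e1 := (te1 k).
Local Notation e2 := (te2 k).
Local Notation e12 := (te12 k).
Local Notation P1 := (P1 k).
Local Notation S1 := (S1 k).
Local Notation S2 := (S2 k).
Implicit Types U V W : rmodule tri.

(* Equivalently, [V] is generated by [V e1], or has no simple factor [S2]. *)
Definition e1_generated V := forall v : V, exists u : V, ract v e2 = ract u e12.

Lemma e1_generated_quotient U V (f : 'Hom(U, V)) :
  is_hom f -> surj f -> e1_generated U -> e1_generated V.
Proof.
move=> fh /surjP fs Ug v; have [u <-] := fs v; have [u' uE] := Ug u.
by exists (f u'); rewrite -!fh uE.
Qed.

Lemma e1_generated_dsum U V :
  e1_generated U -> e1_generated V -> e1_generated (dsum_rmod U V).
Proof.
move=> Ug Vg [u v]; have [u' uE] := Ug u; have [v' vE] := Vg v.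
by exists (u', v'); congr (_, _).
Qed.

Lemma e1_generated_pow U n : e1_generated U -> e1_generated (pow_rmod U n).
Proof.
move=> Ug w; have [w' wE] := fin_all_exists (fun i => Ug (w i)).
by exists [ffun i => w' i]; apply/ffunP=> i; rewrite !ffunE.
Qed.

Lemma e1_generated_summand U V : is_summand U V -> e1_generated V -> e1_generated U.
Proof.
case/summand_retract=> i [r [_ rh iK]]; apply: e1_generated_quotient rh _.
by apply/surjP=> u; exists (i u).
Qed.

Lemma P1_e1_generated : e1_generated P1.
Proof.
move=> [x y]; exists (y, 0); rewrite P1_e12; congr (_, _); rewrite /= ?tri_simp //.
Qed.

Lemma S1_e1_generated : e1_generated S1.
Proof. by move=> x; exists 0; rewrite S1_e12; exact: mulr0. Qed.

Lemma S2_not_e1_generated : ~ e1_generated S2.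
Proof.
move=> S2g; have [u] := S2g 1; rewrite S2_e12 => /eqP.
by rewrite [_ == _](_ : _ = ((1 : k) * 1 == 0)) // mulr1 oner_eq0.
Qed.

Definition tilt : rmodule tri := dsum_rmod P1 S1.

Lemma tilt_e1_generated : e1_generated tilt.
Proof. exact: e1_generated_dsum P1_e1_generated S1_e1_generated. Qed.

(** [S2] is not a quotient of a module generated at vertex 1, which rules out the third
    indecomposable. *)
Lemma tilt_indecomposable U : indecomposable U -> is_summand U tilt ->
  iso_rmod U P1 \/ iso_rmod U S1.
Proof.
move=> Ui UT; case: (tri_indecomposable Ui); [by left | by right |].
case/iso_rmodP=> f [g [fh _ _ gK]]; case: S2_not_e1_generated.
apply: e1_generated_quotient fh _ (e1_generated_summand UT tilt_e1_generated).
by apply/surjP=> v; exists (g v).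
Qed.

Lemma num_indec_tilt : num_indec tilt 2.
Proof.
apply: (num_indec2 (@P1_indecomposable k) (@S1_indecomposable k)).
- by exists S1; exact: iso_rmod_refl.
- by exists P1; exact: iso_dsumC.
- exact: not_iso_P1 (@S1_e12 k).
- exact: tilt_indecomposable.
Qed.

Lemma iso_tri_regular : iso_rmod (dsum_rmod P1 S2) (regular_rmod tri).
Proof.
apply: (@iso_rmodI _ _ (dsum_rmod P1 S2) (regular_rmod tri)
         (fun w => iotaP1 w.1 + iotaS2 w.2)).
- by move=> a v w; rewrite /= iotaP1_linear iotaS2_linear scalerDr addrACA.
- by move=> v a; rewrite /= iotaP1_ract iotaS2_ract mulrDl.
- exists (fun a : tri => ((a.1.1, a.1.2), a.2)) => [[[x y] z]|[[x y] z]].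
    by congr (_, _, _); rewrite /= ?tri_simp.
  by apply: triP; rewrite /= ?tri_simp.
Qed.

Lemma num_indec_tri : num_indec (regular_rmod tri) 2.
Proof.
apply: (num_indec2 (@P1_indecomposable k) (@S2_indecomposable k)).
- by exists S2; exact: iso_tri_regular.
- exists P1; have [f [g [fh gh fK gK]]] := iso_rmodP iso_tri_regular.
  have [f' [g' [fh' gh' fK' gK']]] := iso_rmodP (iso_dsumC S2 P1).
  exists (f \o f')%VF; split; first exact: is_hom_comp.
  by exists (g' \o g)%VF => x; rewrite !comp_lfunE ?fK ?fK' ?gK' ?gK.
- exact: not_iso_P1 (@S2_e12 k).
- move=> U Ui UT; case: (tri_indecomposable Ui); [by left | | by right].
  move=> /iso_rmod_sym/(summand_iso_embedding UT)[j [jh j_inj]].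
  (* A copy of [S1] in [tri] would contain some nonzero x with x e1 = x and x e12 = 0: the first
     makes x a multiple of [e1], the second kills the coefficient. *)
  have j12 : j 1 * e12 = 0 by rewrite -[LHS](jh 1 e12) S1_e12 linear0.
  have j1 : j 1 = j 1 * e1 by rewrite -[RHS](jh 1 e1); congr (j _); rewrite -[RHS]/(1 * 1) mulr1.
  have j11 : (j 1).1.1 = 0.
    by move: j12; rewrite tri_mul_te12 => -[_ + _]; rewrite regularZ mulr1.
  have : (1 : S1) = 0 by apply: j_inj; rewrite linear0 j1 tri_mul_te1 j11 scale0r.
  by move/eqP; rewrite oner_eq0.
Qed.

Lemma embedding_dsum_not_line U (T : rmodule tri) (j : 'Hom(dsum_rmod U U, T)) u t a b :
  injective j -> u != 0 -> j (u, 0) = a *: t -> j (0, u) = b *: t -> False.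
Proof.
move=> j_inj u0 ja jb.
have : j (b *: (u, 0)) = j (a *: (0, u)).
  by rewrite !linearZ /= ja jb !scalerA mulrC.
move/j_inj => -[/eqP]; rewrite scaler0 scaler_eq0 (negPf u0) orbF => /eqP b0 _.
have /j_inj[u00] : j (0, u) = j 0 by rewrite jb b0 scale0r linear0.
by rewrite u00 eqxx in u0.
Qed.

(** Each indecomposable summand is detected on a line of [tilt]: the image of [e12] for [P1], the
    vectors fixed by [e1] and killed by [e12] for [S1]. A summand U + U would put two independent
    vectors on that line. *)
Lemma tilt_basic : basic tilt.
Proof.
move=> U Ui UUT.
have UT : is_summand U tilt := summand_dsuml UUT.
case: (tilt_indecomposable Ui UT) => /iso_rmodP[f [g [fh gh fK gK]]];
  have [j [jh j_inj]] := summand_iso_embedding UUT (iso_rmod_refl _).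
  have u0 : g (0, 1) != 0.
    apply/eqP; rewrite -(linear0 g) => /(can_inj gK)[/eqP].
    by rewrite oner_eq0.
  have gE : g (0, 1) = ract (g (1, 0)) e12 by rewrite -gh P1_e12.
  pose t : tilt := ((0, 1), 0).
  have line (z : tilt) : ract z e12 = z.1.1 *: t.
    by congr (_, _, _); rewrite /= ?regularZ ?tri_simp.
  have jE1 : j (g (0, 1), 0) = ract (j (g (1, 0), 0)) e12.
    by rewrite -jh /= -gE ract0l.
  have jE2 : j (0, g (0, 1)) = ract (j (0, g (1, 0))) e12.
    by rewrite -jh /= -gE ract0l.
  by apply: (embedding_dsum_not_line j_inj u0); rewrite (jE1, jE2); exact: line.
have u0 : g 1 != 0.
  apply/eqP; rewrite -(linear0 g) => /(can_inj gK)/eqP.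
  by rewrite oner_eq0.
pose t : tilt := ((0, 0), 1).
have line (z : tilt) : ract z e1 = z -> ract z e12 = 0 -> z = z.2 *: t.
  case: z => [[x y] w] [] /= _ yE _ [_]; rewrite !tri_simp in yE * => x0 _.
  by congr (_, _, _); rewrite /= ?regularZ ?tri_simp.
have g1 : ract (g 1) e1 = g 1 by rewrite -gh; congr (g _); exact: mulr1.
have g12 : ract (g 1) e12 = 0 by rewrite -gh S1_e12 linear0.
by apply: (embedding_dsum_not_line j_inj u0 (t := t)); apply: line;
  rewrite -jh /= ?g1 ?g12 !ract0l ?linear0.
Qed.

(** Multiplying U + K = V by [e1] gives U e1 = V e1, and V e1 generates V. *)
Lemma superfluous_e1_generated V (K : {vspace V}) :
  e1_generated V -> (forall v, v \in K -> ract v e1 = 0) -> superfluous K.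
Proof.
move=> Vg K0 U Us UK; apply/vspaceP=> v; rewrite memvf.
have e1U u c : ract (ract u e1) c \in U.
  have : u \in (U + K)%VS by rewrite UK memvf.
  by case/memv_addP=> x xU [y yK ->]; rewrite ractDl (K0 y yK) addr0 !Us.
have [u uE] := Vg v; rewrite [v]ract_split uE -ract_e1_e12 memvD ?e1U //.
by rewrite -[ract v e1]ract1 e1U.
Qed.

Let P0 : rmodule tri := dsum_rmod P1 P1.

Definition tilt_cover : 'Hom(P0, tilt) :=
  linfun (fun w : (k^o * k^o) * (k^o * k^o) => (w.1, w.2.1) : (k^o * k^o) * k^o).
Definition tilt_syzygy : 'Hom(S2, P0) :=
  linfun (fun y : k^o => (0, (0, y)) : (k^o * k^o) * (k^o * k^o)).

Lemma tilt_coverE w : tilt_cover w = (w.1, w.2.1).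
Proof. by rewrite /tilt_cover linfunE. Qed.

Lemma tilt_syzygyE y : tilt_syzygy y = (0, (0, y)).
Proof.
rewrite /tilt_syzygy linfunE // => a u v.
by congr (_, (_, _)); rewrite /= ?scaler0 ?addr0.
Qed.

Lemma tilt_presentation : min_proj_presentation tilt_syzygy tilt_cover.
Proof.
split.
- split; first exact: S2_projective.
  by apply: projective_dsum; exact: P1_projective.
- split=> [y a|w a]; rewrite ?tilt_syzygyE ?tilt_coverE; congr (_, _).
  + by congr (_, _); rewrite /= ?tri_simp.
  + by congr (_, _); rewrite /= ?tri_simp.
- split; first by apply/surjP=> -[v x]; exists (v, (x, 0)); rewrite tilt_coverE.
  apply/vspaceP=> w; rewrite memv_ker tilt_coverE; apply/memv_imgP/eqP.
    by case=> y _ ->; rewrite tilt_syzygyE.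
  case: w => [v [x y]] /= [-> ->]; exists y; first exact: memvf.
  by rewrite tilt_syzygyE.
- split.
    apply: superfluous_e1_generated.
      by apply: e1_generated_dsum; exact: P1_e1_generated.
    move=> [[x y] [z w]]; rewrite memv_ker tilt_coverE => /eqP[-> -> ->].
    by congr (_, _, (_, _)); rewrite /= ?tri_simp.
  apply: superfluous0; apply/vspaceP=> y; rewrite memv_ker memv0 tilt_syzygyE.
  by rewrite !xpair_eqE !eqxx.
Qed.

Fact L2_lmodP : is_left_action (fun (a : tri) (v : k^o) => a.2 * v).
Proof.
split=> [v c a b|a c u v|v|a b v] /=.
- by rewrite mulrDl scalerAl.
- by rewrite mulrDr scalerAr.
- by rewrite mul1r.
- by rewrite mulrA.
Qed.

(** The simple left module at vertex 2. Its dual is the simple right module there, a model of tau of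
    [tilt]. *)
Definition L2 : lmodule tri := LModule L2_lmodP.

(** [e1] and [e12] have zero lower right entry, so they act as zero on the dual, whereas every u in
    [U] has the form u e1 + u' e12. *)
Lemma hom_zero_dual_L2 U : e1_generated U -> hom_zero U (dual_rmod L2).
Proof.
move=> Ug f fh; apply/lfunP=> u; rewrite zero_lfunE.
have act0 (xi : dual_rmod L2) (a : tri) : a.2 = 0 -> ract xi a = 0.
  move=> a2; apply/lfunP=> v; rewrite comp_lfunE linfunE; last exact: is_lact_linearr L2_lmodP a.
  by rewrite /= a2 mul0r linear0 zero_lfunE.
have [u' uE] := Ug u.
by rewrite [u]ract_split uE linearD /= !fh !act0 ?addr0.
Qed.

Definition transpose_proj : 'Hom(star S2, L2) :=
  linfun (fun g : star S2 => (vsval g (1 : S2)).2 : k^o).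

Lemma transpose_projE g : transpose_proj g = (vsval g (1 : S2)).2.
Proof. by rewrite /transpose_proj linfunE // => a u v; rewrite /= add_lfunE scale_lfunE. Qed.

(** Evaluation at 1 identifies the star of [S2] with [tri e2], spanned by [e12] and [e2]. The
    dualised syzygy map has image the line of [e12], and reading the lower right entry is the
    quotient by it. *)
Lemma tilt_transpose : is_transpose tilt L2.
Proof.
exists S2, P0, tilt_syzygy, tilt_cover; split; first exact: tilt_presentation.
have syzygy_hom : is_hom tilt_syzygy by case: tilt_presentation => _ [].
exists transpose_proj; split.
- by move=> c g; rewrite !transpose_projE star_actE.
- apply/surjP=> v.
  pose h : 'Hom(S2, regular_rmod tri) := (v : k) *: linfun (@iotaS2 k).
  have hh : is_hom h.
    apply: is_hom_scale; apply: is_hom_linfun; first exact: iotaS2_linear.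
    exact: iotaS2_ract.
  exists (vsproj (hom_space S2 (regular_rmod tri)) h).
  rewrite transpose_projE vsprojK ?(mem_hom_space _).2 //.
  rewrite scale_lfunE linfunE; last exact: iotaS2_linear.
  by rewrite /= regularZ mulr1.
- apply/vspaceP=> g; rewrite memv_ker transpose_projE; apply/eqP/memv_imgP.
    move=> g12; have gh : is_hom (vsval g) by apply/mem_hom_space; exact: subvsP.
    pose y := (vsval g (1 : S2)).1.2.
    have g1 : vsval g (1 : S2) = y *: te12 k.
      have gE : vsval g (1 : S2) = vsval g (1 : S2) * e2.
        by rewrite -[RHS](gh (1 : S2) e2); congr (vsval g _); rewrite /= mulr1.
      rewrite gE tri_mul_te2 g12 scale0r addr0 //.
    (* Sending the generator of the second [P1] to [y e1] restricts to multiplication by [y e12] on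
       its socle. *)
    pose h : 'Hom(P0, regular_rmod tri) := (P1_hom (y *: 1 : regular_rmod tri) \o dprr P1 P1)%VF.
    have hh : is_hom h by apply: is_hom_comp; [exact: P1_homP | exact: dprr_hom].
    exists (vsproj (hom_space P0 (regular_rmod tri)) h); first exact: memvf.
    apply/val_inj; apply: (etrans _ (esym (star_mapE _ syzygy_hom))).
    apply/lfunP=> x; rewrite vsprojK ?(mem_hom_space _).2 //.
    rewrite !comp_lfunE tilt_syzygyE dprrE P1_homE /=.
    have -> : x = ract (1 : S2) (iotaS2 x) by rewrite S2_gen.
    rewrite gh g1; apply: triP; rewrite /= ?regularZ ?tri_simp //.
  case=> h _ ->; rewrite star_mapE // comp_lfunE tilt_syzygyE.
  have hh : is_hom (vsval h) by apply/mem_hom_space; exact: subvsP.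
  (* The socle of the second [P1] is spanned by its generator times [e12], so [h] maps it into
     [tri e12], where lower right entries vanish. *)
  rewrite (_ : (0, (0, 1)) = ract ((0, (1, 0)) : P0) e12) ?hh.
    by rewrite /= mulr0.
  by congr (_, _, (_, _)); rewrite /= ?tri_simp.
Qed.

Lemma tilt_tau_rigid : tau_rigid tilt.
Proof.
exists (dual_rmod L2); split; last exact: hom_zero_dual_L2 tilt_e1_generated.
by exists L2; split; [exact: tilt_transpose | exact: iso_rmod_refl].
Qed.

Lemma tilt_support_tau_tilting : basic_support_tau_tilting tilt.
Proof.
split; last exact: tilt_basic; split; first exact: tilt_tau_rigid.
(* Since |tilt| = |tri| = 2, the projective is zero; it is realised as the empty power. *)
pose Z := pow_rmod tilt 0; have Z0 : is_zero_mod Z := @pow0_zero _ _ tilt.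
exists Z; split; first exact: projective_zero.
  by move=> f _; apply/lfunP=> z; rewrite (Z0 z) zero_lfunE linear0.
exists 2, 0, 2; split=> //.
- exact: num_indec_tilt.
- exact: num_indec_zero.
- exact: num_indec_tri.
Qed.

End SupportTauTilting.

(** * The Morita context and its glued class *)

Section Example.
Variable k : fieldType.
Local Notation tri := (tri k).
Local Notation e1 := (te1 k).
Local Notation e2 := (te2 k).
Local Notation e12 := (te12 k).
Local Notation tilt := (tilt k).

Lemma Fac_tilt (V : rmodule tri) : Fac tilt V <-> e1_generated V.
Proof.
split=> [/Fac_pow[n [f [fh fs]]]|Vg].
  exact: e1_generated_quotient fh fs (e1_generated_pow (@tilt_e1_generated k)).
pose v i := (vbasis (fullv : {vspace V}))`_i.
pose h (i : 'I_(\dim (fullv : {vspace V}))) : 'Hom(tilt, V) :=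
  (P1_hom (v i) \o dprl _ _)%VF.
apply: (@Fac_gen _ _ _ _ _ h) => [i|w].
  by apply: is_hom_comp; [exact: P1_homP | exact: dprl_hom].
have [u uE] := Vg w; pose c i := coord (vbasis (fullv : {vspace V})) i.
(* These coordinates expand w = w e1 + u e12 over the basis [v]. *)
exists (fun i => ((c i w, c i u), 0)).
have hE i : h i ((c i w, c i u), 0) = c i w *: ract (v i) e1 + c i u *: ract (v i) e12.
  rewrite comp_lfunE dprlE P1_homE /= -!ractZr -ractDr; congr (ract _ _).
  by apply: triP; rewrite /= ?regularZ ?tri_simp.
rewrite (eq_bigr _ (fun i _ => hE i)) big_split /=.
have ract_coord (x : V) a : ract x a = \sum_i c i x *: ract (v i) a.
  rewrite {1}(coord_vbasis (memvf x)) (big_morph _ (ractDl a) (ract0l _ a)).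
  by apply: eq_bigr=> i _; rewrite ractZl.
by rewrite -!ract_coord [w in RHS]ract_split uE.
Qed.

(** [i 1] is a left unit for each [i a], so [w (i a)] depends only on the projection of [w] to the
    corner. *)
Lemma corner_e1_generated (L : falgType k) (i : tri -> L) (i_lin : linear i)
    (iM : forall a b, i (a * b) = i a * i b) (W : rmodule L) :
  e1_generated (corner_rmod i_lin iM W) <->
  forall w : W, exists u : W, ract w (i e2) = ract u (i e12).
Proof.
have ract_i1 (w : W) a : ract (ract w (i 1)) (i a) = ract w (i a).
  by rewrite -ractM -iM mul1r.
have mem_i1 (w : W) : ract w (i 1) \in corner_space i W.
  by apply/corner_spaceP => //; rewrite ract_i1.
split=> [Wg w|Wg v].
  have [u /(congr1 val)] := Wg (vsproj _ (ract w (i 1))).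
  rewrite /= !corner_actE // vsprojK // ract_i1 => uE.
  by exists (vsval u).
have [u uE] := Wg (vsval v); exists (vsproj _ (ract u (i 1))).
by apply/val_inj; rewrite /= !corner_actE // vsprojK // ract_i1.
Qed.

Fact arrow_lactP : is_left_action (fun (a : tri) (v : k^o) => a.1.1 * v).
Proof.
split=> [v c a b|a c u v|v|a b v] /=.
- by rewrite mulrDl scalerAl.
- by rewrite mulrDr scalerAr.
- by rewrite mul1r.
- by rewrite mulrA.
Qed.

Fact arrow_ractP : is_right_action (fun (v : k^o) (a : tri) => v * a.2).
Proof. exact: S2_rmodP. Qed.

Fact arrow_ractA (a : tri) (v : k^o) (b : tri) :
  a.1.1 * (v * b.2) = (a.1.1 * v) * b.2.
Proof. exact: mulrA. Qed.

(* k e1 \otimes e2 k: one arrow from the first vertex of one copy of [tri] to  *)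
(* the second vertex of the other.                                             *)
Definition arrow_bimod : bimodule tri tri :=
  Bimodule arrow_lactP arrow_ractP arrow_ractA.

(** Zero is the only choice: [e2] acts as the identity on the right of [arrow_bimod] and as zero on
    the left, so the tensor product over [tri] vanishes. *)
Fact zero_pairing : is_bimodule_pairing (fun (_ _ : arrow_bimod) => 0 : tri).
Proof.
split=> // [m a u v|n a u v|a n m|n m a]; rewrite ?scaler0 ?addr0 //.
- by rewrite mulr0.
- by rewrite mul0r.
Qed.

Fact zero_pairing_assoc (n m n' : arrow_bimod) :
  blact (0 : tri) n' = bract n (0 : tri).
Proof. by rewrite /= mul0r mulr0. Qed.

Definition ctx : morita_context k :=
  MoritaContext zero_pairing zero_pairing zero_pairing_assoc
    (fun m n m' => esym (zero_pairing_assoc m n m')).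


Local Notation Lam := (morita_alg ctx).

Definition arrow12 : Lam := inA (e12 : mcA ctx).
Definition arrow34 : Lam := inB (e12 : mcB ctx).
Definition arrow14 : Lam := ((0, 1), (0, 0)).
Definition arrow32 : Lam := ((0, 0), (1, 0)).

(** * Band modules with monodromy J *)

Section Band.
Variables (V : vectType k) (J : 'End(V)).

(* The representation V = V <-J- V = V = V of that quiver. *)
Definition band_act (w : (V * V) * (V * V)) (x : Lam) : (V * V) * (V * V) :=
  let a : tri := x.1.1 in let n : k := x.1.2 in
  let m : k := x.2.1 in let b : tri := x.2.2 in
  ((a.1.1 *: w.1.1, a.1.2 *: w.1.1 + a.2 *: w.1.2 + m *: J w.2.1),
   (b.1.1 *: w.2.1, n *: w.1.1 + b.1.2 *: w.2.1 + b.2 *: w.2.2)).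

Fact band_rmodP : is_right_action band_act.
Proof.
have sum3 (p q r p' q' r' : V) : (p + p') + (q + q') + (r + r') = p + q + r + (p' + q' + r').
  by rewrite (addrACA p) [LHS]addrACA.
split=> [x a u v|u a x y|[[v1 v2] [v3 v4]]|u x y].
- by congr (_, _, (_, _)); rewrite /= !linearP //= !scalerDr;
    rewrite sum3.
- have lin x1 y1 (t : V) : (a *: (x1 : k^o) + y1 : k) *: t = a *: (x1 *: t) + y1 *: t.
    by rewrite scalerDl scalerA.
  congr (_, _, (_, _)); rewrite /= !lin // !scalerDr;
    by rewrite sum3.
- by congr (_, _, (_, _)); rewrite /= ?scale1r ?scale0r ?addr0 ?add0r.
- case: x y => [[a n] [m b]] [[a' n'] [m' b']].
  congr (_, _, (_, _)); rewrite /= ?(addr0, add0r).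
  + by rewrite scalerA mulrC.
  + have JZ c (t : V) : J (c *: t) = c *: J t by rewrite linearZ.
    rewrite JZ !(scalerDr, scalerDl, scalerA) !addrA.
    by rewrite (mulrC a'.1.2) !(mulrC a'.2) (mulrC m').
  + by rewrite scalerA mulrC.
  + rewrite !(scalerDr, scalerDl, scalerA).
    rewrite (addrACA (_ *: u.1.1)) -!addrA.
    by rewrite (mulrC b'.1.2) !(mulrC b'.2) (mulrC n').
Qed.

Definition band : rmodule Lam := RModule band_rmodP.

Lemma band_inA_e2 (w : band) : ract w (inA (e2 : mcA ctx)) = ((0, w.1.2), (0, 0)).
Proof. by congr (_, _, (_, _)); rewrite /= ?(scale0r, scale1r, addr0, add0r). Qed.

Lemma band_inB_e2 (w : band) : ract w (inB (e2 : mcB ctx)) = ((0, 0), (0, w.2.2)).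
Proof. by congr (_, _, (_, _)); rewrite /= ?(scale0r, scale1r, addr0, add0r). Qed.

Lemma band_arrow12 (w : band) : ract w arrow12 = ((0, w.1.1), (0, 0)).
Proof. by congr (_, _, (_, _)); rewrite /= ?(scale0r, scale1r, addr0, add0r). Qed.

Lemma band_arrow34 (w : band) : ract w arrow34 = ((0, 0), (0, w.2.1)).
Proof. by congr (_, _, (_, _)); rewrite /= ?(scale0r, scale1r, addr0, add0r). Qed.

Lemma band_arrow14 (w : band) : ract w arrow14 = ((0, 0), (0, w.1.1)).
Proof. by congr (_, _, (_, _)); rewrite /= ?(scale0r, scale1r, addr0, add0r). Qed.

Lemma band_arrow32 (w : band) : ract w arrow32 = ((0, J w.2.1), (0, 0)).
Proof. by congr (_, _, (_, _)); rewrite /= ?(scale0r, scale1r, addr0, add0r). Qed.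

End Band.

Local Notation glued :=
  (glued_class (tilt : rmodule (mcA ctx)) (tilt : rmodule (mcB ctx))).

Lemma gluedP (W : rmodule Lam) :
  glued W <->
  (forall w : W, exists u : W, ract w (inA (e2 : mcA ctx)) = ract u arrow12) /\
  (forall w : W, exists u : W, ract w (inB (e2 : mcB ctx)) = ract u arrow34).
Proof.
rewrite /glued_class; split=> -[].
  by move=> /Fac_tilt/corner_e1_generated gA /Fac_tilt/corner_e1_generated gB; split.
by move=> gA gB; split; apply/Fac_tilt/corner_e1_generated.
Qed.

Lemma band_glued (V : vectType k) (J : 'End(V)) : glued (band J).
Proof.
apply/gluedP; split=> w.
  by exists ((w.1.2, 0), (0, 0)); rewrite band_inA_e2 band_arrow12.
by exists ((0, 0), (w.2.2, 0)); rewrite band_inB_e2 band_arrow34.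
Qed.

(* In a glued module the arrows 1 -> 2 and 3 -> 4 are onto, so the relation    *)
(* going once round the cycle from vertex 1 to vertex 1 contains the graph of a *)
(* linear map.                                                                   *)
Lemma glued_monodromy (G : rmodule Lam) : glued G ->
  exists mu : 'End(G), forall (V : vectType k) (J : 'End(V)) (h : 'Hom(G, band J)),
    is_hom h -> forall w, (h (mu w)).1.1 = J (h w).1.1.
Proof.
case/gluedP=> onto12 onto34.
pose r (x : Lam) : 'End(G) := linfun (fun w : G => ract w x).
have rE x w : r x w = ract w x by apply: linfunE; exact: ract_linearl.
(* Along 1 -> 4, back to 3, along 3 -> 2, back to 1; each inverse is a linear section over the image
   of its arrow. *)
pose mu := ((r arrow12)^-1 \o r arrow32 \o (r arrow34)^-1 \o r arrow14)%VF.
exists mu => V J h hh w; pose u := ((r arrow34)^-1 (r arrow14 w))%VF.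
have uE : ract u arrow34 = ract w arrow14.
  rewrite -!rE limg_lfunVK //.
  (* [arrow14] ends at vertex 4, where [arrow34] is onto; likewise below for [arrow32] and [arrow12]
     at vertex 2. *)
  have [v vE] := onto34 (ract w arrow14).
  suff -> : r arrow14 w = r arrow34 v by rewrite memv_img ?memvf.
  rewrite !rE -vE -ractM; congr (ract _ _).
  by congr (_, _, (_, _)); rewrite /= ?tri_simp.
have muE : ract (mu w) arrow12 = ract u arrow32.
  rewrite -!rE /mu !comp_lfunE -/u limg_lfunVK //.
  have [v vE] := onto12 (ract u arrow32).
  suff -> : r arrow32 u = r arrow12 v by rewrite memv_img ?memvf.
  rewrite !rE -vE -ractM; congr (ract _ _).
  by congr (_, _, (_, _)); rewrite /= ?tri_simp.
(* In the band, [uE] equates coordinate 3 of [h u] with coordinate 1 of [h w], and [muE] equates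
   coordinate 1 of [h (mu w)] with J of coordinate 3 of [h u]. *)
have := congr1 h uE; rewrite !hh band_arrow34 band_arrow14 => -[hu].
by have := congr1 h muE; rewrite !hh band_arrow12 band_arrow32 hu => -[].
Qed.

(** * A nilpotent Jordan block and its cyclic vectors *)

Section Shift.
Variable n : nat.
Local Notation V := {ffun 'I_n.+1 -> k^o}.

Definition shift_fun (x : V) : V :=
  [ffun i : 'I_n.+1 => (if val i is j.+1 then x (inord j) else 0) : k^o].

Fact shift_linear : linear shift_fun.
Proof.
move=> a x y; apply/ffunP=> -[[|i] lt_i]; rewrite !ffunE /=.
  by rewrite scaler0 addr0.
by rewrite !ffunE.
Qed.

Definition shift : 'End(V) := linfun shift_fun.

Lemma iter_shiftE (x : V) i (j : 'I_n.+1) :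
  iter i shift x j = if (i <= j)%N then x (inord (j - i)) else 0.
Proof.
elim: i j => [|i IHi] j; first by rewrite /= subn0 inord_val.
rewrite iterS (linfunE shift_linear) ffunE; case: j => [[|j] lt_j] //=.
have lt_j' : (j < n.+1)%N by exact: ltnW.
by rewrite IHi inordK.
Qed.

(** The i-th iterate starts with i zeros followed by [x ord0], so the system is triangular: once the
    earlier coefficients vanish, coordinate i of the sum is [c i * x ord0]. *)
Lemma iter_shift_free (x : V) (c : 'I_n.+1 -> k) :
  x ord0 != 0 -> \sum_(i < n.+1) c i *: iter i shift x = 0 -> forall i, c i = 0.
Proof.
move=> x0 sum0; have c0 m : forall i : 'I_n.+1, (i < m)%N -> c i = 0.
  elim: m => // m IHm i; rewrite ltnS leq_eqVlt => /orP[/eqP im|]; last exact: IHm.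
  have := congr1 (fun v : V => v i) sum0.
  rewrite sum_ffunE (bigD1 i) //= big1 => [|j ji].
    rewrite !ffunE iter_shiftE leqnn subnn addr0 (_ : inord 0 = ord0); last first.
      by apply/val_inj; rewrite /= inordK.
    by move/eqP; rewrite scaler_eq0 (negPf x0) orbF => /eqP.
  rewrite ffunE iter_shiftE; case: leqP => [ij|_]; last by rewrite scaler0.
  by rewrite IHm ?scale0r // -im ltn_neqAle ji.
by move=> i; apply: (c0 n.+1).
Qed.

End Shift.

(** With a block of size dim G + 1, generation yields a hom [h] and a [g] for which [h g] is cyclic
    at vertex 1. There [h] turns iterates of [mu] into iterates of the shift, so dim G + 1 vectors
    of G would be independent. *)
Lemma glued_not_finitely_generated (G : rmodule Lam) :
  glued G -> ~ (forall W, glued W -> Fac G W).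
Proof.
case/glued_monodromy=> mu muP Gfac; pose n := \dim (fullv : {vspace G}).
pose W := band (shift n).
pose l : 'Hom(W, k^o) := linfun (fun w : W => (w.1.1 : {ffun 'I_n.+1 -> k^o}) ord0).
have lE w : l w = (w.1.1 : {ffun 'I_n.+1 -> k^o}) ord0.
  by rewrite /l linfunE // => a u v; rewrite !ffunE.
(* [w1] witnesses that [l] is nonzero on the band. *)
pose w1 : W := (([ffun => 1], 0), (0, 0)).
have [|h [g [hh]]] := Fac_functional (Gfac _ (band_glued (shift n))) (l := l) (w := w1).
  by rewrite lE ffunE oner_eq0.
rewrite lE => hg0.
have iterE i : (h (iter i mu g)).1.1 = iter i (shift n) (h g).1.1.
  by elim: i => //= i <-; exact: muP.
pose X : n.+1.-tuple G := [tuple iter i mu g | i < n.+1].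
have freeX : free X.
  apply/freeP=> c sum0; apply: (iter_shift_free hg0).
  have := congr1 (fun v : G => (h v).1.1) sum0.
  rewrite linear0 linear_sum (big_morph (fun w : W => w.1.1) (fun _ _ => erefl) erefl).
  move=> hsum0; apply: etrans hsum0.
  by apply: eq_bigr=> i _; rewrite -(tnth_nth 0 X) tnth_mktuple linearZ /= -iterE.
have := dimvS (subvf <<X>>%VS).
by rewrite (eqP freeX) size_tuple ltnn.
Qed.

End Example.

Theorem proposition3p10 (k : fieldType) :
  (exists (c : morita_context k) (X : rmodule (mcA c)) (Y : rmodule (mcB c)),
     [/\ basic_support_tau_tilting X,
         basic_support_tau_tilting Y,
         ~ functorially_finite (glued_class X Y)
       & ~ exists G : rmodule (morita_alg c),
             support_tau_tilting G /\
             (forall W : rmodule (morita_alg c), Fac G W <-> glued_class X Y W)])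
  /\
  (forall Gamma : gluing_procedure k,
     ~ (forall (c : morita_context k) (X : rmodule (mcA c)) (Y : rmodule (mcB c))
          (hX : basic_support_tau_tilting X) (hY : basic_support_tau_tilting Y),
          support_tau_tilting (Gamma c X Y hX hY) /\
          (forall W : rmodule (morita_alg c),
             Fac (Gamma c X Y hX hY) W <-> glued_class X Y W))).
Proof.
have sttX := tilt_support_tau_tilting k.
have no_generator (G : rmodule (morita_alg (ctx k))) :
    ~ (forall W, Fac G W <-> glued_class (tilt k : rmodule (mcA (ctx k)))
                                         (tilt k : rmodule (mcB (ctx k))) W).
  (* G lies in Fac G, so it would be a member generating the class. *)
  move=> FacG; apply: (@glued_not_finitely_generated k G).
    by apply/FacG; exact: Fac_refl.
  by move=> W /FacG.
split=> [|Gamma GammaP].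
  exists (ctx k), (tilt k), (tilt k); split=> // [ff|[G [_ /no_generator]]] //.
  have [[CL [f fP]] _] := ff (regular_rmod _); have [CLglued _ _] := fP.
  apply: (glued_not_finitely_generated CLglued) => W.
  exact: left_approx_regular_Fac fP.
by have [_ /no_generator] := GammaP (ctx k) (tilt k) (tilt k) sttX sttX.
Qed.
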